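(* There is a one-to-one correspondence between projective equivalence classes of simple infinite valuated matroids (on arbitrary sets) and isomorphism classes of geometric $\mathbb{R}_{\max}$-modules, given by $M\mapsto Q_M$. That is: for every simple infinite valuated matroid $M$, $Q_M$ is a geometric $\mathbb{R}_{\max}$-module; two simple infinite valuated matroids $M,M'$ are projectively equivalent if and only if $Q_M\cong Q_{M'}$; and every geometric $\mathbb{R}_{\max}$-module is isomorphic to $Q_M$ for some simple infinite valuated matroid $M$.
   Context: $\mathbb{R}_{\max}=\mathbb{R}\cup\{-\infty\}$ with addition $\max$ and multiplication the usual addition of reals, written multiplicatively; zero $0:=-\infty$, unit $1$ (the real number $0$), $\mathbb{R}_{\max}^\times=\mathbb{R}$. Modules are commutative monoids with an action satisfying the usual module axioms; a module over $\mathbb{R}_{\max}$ is ordered by $x\le y\iff x+y=y$. Valuated matroid on a finite set $S$ (circuit description): a collection $\mathcal{C}\subseteq \mathbb{R}_{\max}^S$ of functions, called circuits, such that, writing $\underline{X}=\{e\in S\mid X(e)\ne-\infty\}$: the constant function $-\infty$ is not in $\mathcal{C}$; if $X,Y\in\mathcal{C}$ and $\underline X\neq\underline Y$ then $\underline X\not\subseteq\underline Y$; if $X\in\mathcal{C}$ and $a\in\mathbb{R}_{\max}^\times$ then $aX\in\mathcal{C}$; and for $X,Y\in\mathcal{C}$ and $u,v\in S$ with $X(u)=Y(u)\neq-\infty$ and $X(v)>Y(v)$ there is $Z\in\mathcal{C}$ with $Z(u)=-\infty$, $Z(v)=X(v)$ and $Z\le\max(X,Y)$ pointwise. For $S'\subseteq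 S$, the restriction to $S'$ is the valuated matroid on $S'$ whose circuits are the circuits with support contained in $S'$ (restricted to $S'$). An infinite valuated matroid $M$ on an arbitrary (possibly finite) set $E$ is a choice of a valuated matroid $M|_S$ on each finite $S\subseteq E$ with $(M|_S)|_{S'}=M|_{S'}$ for all $S'\subseteq S$. Its circuits are the functions $E\to\mathbb{R}_{\max}$ obtained by extending circuits of the $M|_S$ ($S$ finite) by $-\infty$. $M$ is simple if every circuit has support of size at least $3$. $Q_M$ is the quotient of the free $\mathbb{R}_{\max}$-module on $E$ by the congruence generated by $\sum_{y\in E}c(y)y=\sum_{y\in E\setminus\{x\}}c(y)y$ for every circuit $c$ and every $x\in E$. $M$ on $E$ and $M'$ on $E'$ are projectively equivalent if there are a bijection $\phi:E\to E'$ and a map $s:E\to\mathbb{R}_{\max}^\times$ such that $\eta:E\to\mathbb{R}_{\max}$ is a circuit of $M$ iff $y\mapsto s(\phi^{-1}(y))\eta(\phi^{-1}(y))$ is a circuit of $M'$. Let $N$ be an $\mathbb{R}_{\max}$-module, $\mathcal{O}=\{a\in\mathbb{R}_{\max}\mid a\le1\}$. For $x\le y$ in $N$, $[x,y]=\{z\mid x\le z\le y\}$. $y$ weakly covers $x$ ($x\preceq y$) if $x\le y$ and every element of $[x,y]$ has the form $x+ay$ with $a\in\mathcal{O}$. $y$ covers $x$ if $x\le y$ and $\mathcal{O}\to[x,y]$, $a\mapsto x+ay$, is a bijection. $x$ is an atom if it covers $0$. $N$ is atomic if every element is a (finite, possibly empty) sum of atoms. $N$ is semimodular if $x\preceq y$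 implies $x+z\preceq y+z$ for all $x,y,z\in N$. $N$ is strongly torsion-free if (i) $ax\ne0$ whenever $x\in N\setminus\{0\}$ and $a\in\mathbb{R}_{\max}\setminus\{0\}$, and (ii) whenever $x\le y$ in $N$, $a,b\in\mathcal{O}$ and $x+ay=x+by$, then $a=b$ or $x=x+ay=x+by$. $N$ is geometric if it is atomic, semimodular and strongly torsion-free. *)

(* Defs.v *)
From HB Require Import structures.
From mathcomp Require Import all_boot all_order all_algebra finmap generic_quotient.
From mathcomp Require Import boolp classical_sets functions cardinality fsbigop.
From mathcomp Require Import reals constructive_ereal.

Set Implicit Arguments.
Unset Strict Implicit.
Unset Printing Implicit Defensive.

Import Order.TTheory GRing.Theory Num.Theory.
Local Open Scope classical_set_scope.
Local Open Scope ring_scope.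
Local Open Scope quotient_scope.

(* R_max is the subtype of [\bar R] obtained by leaving out +oo; it inherits
   the order of [\bar R] but its semiring structure is (max, +): in ring_scope,
   [0 : Rmax R] is -oo and [1 : Rmax R] is the real number 0.  The elements
   of R_max^x are those different from 0. *)
Record Rmax (R : realType) := MkRmax {
  rmax_val : \bar R;
  _ : rmax_val != +oo%E
}.

HB.instance Definition _ (R : realType) := [isSub for @rmax_val R].
HB.instance Definition _ (R : realType) := [Choice of Rmax R by <:].
HB.instance Definition _ (R : realType) :=
  [SubChoice_isSubOrder of Rmax R by <: with ring_display].

Section RmaxSemiring.
Context {R : realType}.
Implicit Types a b c : Rmax R.

Let maxN a b : Order.max (val a) (val b) != +oo%E.
Proof. by rewrite /Order.max; case: ifP => _; [case: b|case: a]. Qed.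

Let addN a b : (val a + val b)%E != +oo%E.
Proof. by case: a b => [[r| |] ?] [[s| |] ?]. Qed.

Definition rmax_zero : Rmax R := @MkRmax R -oo%E isT.
Definition rmax_one : Rmax R := @MkRmax R 0%:E isT.
Definition rmax_add a b : Rmax R := MkRmax (maxN a b).
Definition rmax_mul a b : Rmax R := MkRmax (addN a b).

Let addA : associative rmax_add.
Proof. by move=> a b c; apply/val_inj/maxA. Qed.
Let addC : commutative rmax_add.
Proof. by move=> a b; apply/val_inj/maxC. Qed.
Let add0 : left_id rmax_zero rmax_add.
Proof. by move=> a; apply/val_inj/max_r; rewrite /= leNye. Qed.

HB.instance Definition _ := GRing.isNmodule.Build (Rmax R) addA addC add0.

Let mulA : associative rmax_mul.
Proof. by move=> a b c; apply/val_inj/addeA. Qed.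
Let mulC : commutative rmax_mul.
Proof. by move=> a b; apply/val_inj/addeC. Qed.
Let mul1 : left_id rmax_one rmax_mul.
Proof. by move=> a; apply/val_inj/add0e. Qed.
Let mulD : left_distributive rmax_mul +%R.
Proof.
move=> a b c; apply/val_inj; rewrite /=.
by case: (leP (val a) (val b)) => ab; [rewrite max_r|rewrite max_l];
  rewrite ?leeD2r // ltW.
Qed.
Let mul0 : left_zero (0 : Rmax R) rmax_mul.
Proof. by move=> [[r| |] ra]; apply/val_inj. Qed.
Let one_neq0 : rmax_one != 0.
Proof. by []. Qed.

HB.instance Definition _ :=
  GRing.Nmodule_isComNzSemiRing.Build (Rmax R) mulA mulC mul1 mulD mul0 one_neq0.

End RmaxSemiring.

Section Modules.
Context {R : realType} {N : lSemiModType (Rmax R)}.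
Implicit Types x y z : N.

Definition mle x y : Prop := x + y = y.

Definition minterval x y : set N := [set z | mle x z /\ mle z y].

Definition Oset : set (Rmax R) := [set a : Rmax R | a <= 1].

Definition weakly_covers x y : Prop :=
  mle x y /\
  forall z, minterval x y z -> exists2 a : Rmax R, Oset a & z = x + a *: y.

Definition covers x y : Prop :=
  mle x y /\ set_bij Oset (minterval x y) (fun a : Rmax R => x + a *: y).

Definition atom x : Prop := covers 0 x.

End Modules.

Section GeometricModules.
Context {R : realType}.
Variable N : lSemiModType (Rmax R).

Definition atomic : Prop :=
  forall x : N, exists s : seq N, {in s, forall y, atom y} /\ x = \sum_(y <- s) y.

Definition semimodular : Prop :=
  forall x y z : N, weakly_covers x y -> weakly_covers (x + z) (y + z).

Definition strongly_torsion_free : Prop :=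
  (forall (x : N) (a : Rmax R), x != 0 -> a != 0 -> a *: x != 0) /\
  (forall (x y : N) (a b : Rmax R), mle x y -> Oset a -> Oset b ->
     x + a *: y = x + b *: y ->
     a = b \/ (x = x + a *: y /\ x = x + b *: y)).

Definition geometric : Prop :=
  [/\ atomic, semimodular & strongly_torsion_free].

End GeometricModules.

Definition module_iso {R : realType} (N N' : lSemiModType (Rmax R)) : Prop :=
  exists f : {linear N -> N'}, bijective f.

Section ValuatedMatroids.
Variables (R : realType) (S : finType).
Implicit Types (C : set {ffun S -> Rmax R}) (X Y Z : {ffun S -> Rmax R}).

Definition vsupp X : {set S} := [set e | X e != 0]%SET.

Record is_valuated_matroid C : Prop := IsValuatedMatroid {
  vm_nonzero : ~ C [ffun=> 0];
  vm_incomparable : forall X Y, C X -> C Y ->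
    vsupp X != vsupp Y -> ~~ (vsupp X \subset vsupp Y);
  vm_scale : forall X (a : Rmax R), C X -> a != 0 -> C [ffun e => a * X e];
  vm_elimination : forall X Y u v, C X -> C Y ->
    X u = Y u -> X u != 0 -> Y v < X v ->
    exists Z, [/\ C Z, Z u = 0, Z v = X v &
                  forall e, Z e <= Order.max (X e) (Y e)]
}.

End ValuatedMatroids.

Definition vm_restrict {R : realType} {E : choiceType} (S S' : {fset E})
    (sub : (S' `<=` S)%fset) (C : set {ffun S -> Rmax R}) :
    set {ffun S' -> Rmax R} :=
  [set [ffun e => X (fincl sub e)]
    | X in [set X | C X /\ forall e : S, e \in vsupp X -> val e \in S']].

(* The ground set is a [choiceType], which classically is no restriction
   (every type carries such a structure, see [gen_choiceMixin] in [boolp]). *)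
Record infinite_valuated_matroid (R : realType) (E : choiceType) := IVM {
  ivm_on : forall S : {fset E}, set {ffun S -> Rmax R};
  ivm_matroid : forall S : {fset E}, is_valuated_matroid (@ivm_on S);
  ivm_restrict : forall (S S' : {fset E}) (sub : (S' `<=` S)%fset),
    vm_restrict sub (@ivm_on S) = @ivm_on S'
}.
Arguments ivm_on {R E} _ _ _.

Section InfiniteValuatedMatroids.
Context {R : realType} {E : choiceType}.
Implicit Type M : infinite_valuated_matroid R E.

Definition extend0 (S : {fset E}) (X : {ffun S -> Rmax R}) : E -> Rmax R :=
  fun y => if insub y is Some e then X e else 0.

Definition circuit M : set (E -> Rmax R) :=
  [set eta | exists (S : {fset E}) (X : {ffun S -> Rmax R}),
     ivm_on M S X /\ eta = extend0 X].

Definition simple M : Prop :=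
  forall eta, circuit M eta -> (`I_3 #<= [set y | eta y != 0])%card.

End InfiniteValuatedMatroids.

Definition projectively_equivalent {R : realType} {E E' : choiceType}
    (M : infinite_valuated_matroid R E)
    (M' : infinite_valuated_matroid R E') : Prop :=
  exists (phi : E -> E') (phi' : E' -> E) (s : E -> Rmax R),
    [/\ cancel phi phi', cancel phi' phi, (forall x, s x != 0) &
        forall eta : E -> Rmax R,
          circuit M eta <-> circuit M' (fun y => s (phi' y) * eta (phi' y))].

Section FreeModule.
Variables (R : realType) (E : choiceType).

Definition free_module := {fsfun E -> Rmax R with 0}.

HB.instance Definition _ := Choice.on free_module.

Implicit Types f g h : free_module.

Definition free_add f g : free_module :=
  [fsfun x in (finsupp f `|` finsupp g)%fset => f x + g x | 0].
Definition free_scale (a : Rmax R) f : free_module :=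
  [fsfun x in finsupp f => a * f x | 0].

Lemma free_addE f g x : free_add f g x = f x + g x.
Proof.
rewrite fsfun_fun in_fsetU; case: ifP => // /negbT; rewrite negb_or => /andP[].
by move=> /fsfun_dflt -> /fsfun_dflt ->; rewrite addr0.
Qed.

Lemma free_scaleE a f x : free_scale a f x = a * f x.
Proof.
rewrite fsfun_fun; case: ifP => // /negbT.
by move=> /fsfun_dflt ->; rewrite mulr0.
Qed.

Let addA : associative free_add.
Proof. by move=> f g h; apply/fsfunP => x; rewrite !free_addE addrA. Qed.
Let addC : commutative free_add.
Proof. by move=> f g; apply/fsfunP => x; rewrite !free_addE addrC. Qed.
Let add0 : left_id ([fsfun] : free_module) free_add.
Proof. by move=> f; apply/fsfunP => x; rewrite free_addE fsfun0E add0r. Qed.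

HB.instance Definition _ := GRing.isNmodule.Build free_module addA addC add0.

Let scaleA a b f : free_scale a (free_scale b f) = free_scale (a * b) f.
Proof. by apply/fsfunP => x; rewrite !free_scaleE mulrA. Qed.
Let scale0 f : free_scale 0 f = 0.
Proof. by apply/fsfunP => x; rewrite free_scaleE mul0r fsfun0E. Qed.
Let scale1 : left_id 1 free_scale.
Proof. by move=> f; apply/fsfunP => x; rewrite free_scaleE mul1r. Qed.
Let scaleDr : right_distributive free_scale +%R.
Proof.
by move=> a f g; apply/fsfunP => x; rewrite !(free_scaleE, free_addE) mulrDr.
Qed.
Let scaleDl f : {morph free_scale^~ f : a b / a + b}.
Proof.
by move=> a b; apply/fsfunP => x; rewrite !(free_scaleE, free_addE) mulrDl.
Qed.

HB.instance Definition _ := GRing.Nmodule_isLSemiModule.Build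
  (Rmax R) free_module scaleA scale0 scale1 scaleDr scaleDl.

Definition free_gen (y : E) : free_module := [fsfun x in [fset y]%fset => 1 | 0].

End FreeModule.

Section Quotient.
Context {R : realType} (V : lSemiModType (Rmax R)).

Record congruence (r : V -> V -> Prop) : Prop := Congruence {
  congruence_refl : forall u, r u u;
  congruence_sym : forall u v, r u v -> r v u;
  congruence_trans : forall u v w, r u v -> r v w -> r u w;
  congruence_add : forall u u' v v', r u u' -> r v v' -> r (u + v) (u' + v');
  congruence_scale : forall (a : Rmax R) u v, r u v -> r (a *: u) (a *: v)
}.

Variable gens : V -> V -> Prop.

Definition generated_congruence (u v : V) : Prop :=
  forall r, congruence r -> (forall u' v', gens u' v' -> r u' v') -> r u v.

Lemma generated_congruenceP : congruence generated_congruence.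
Proof.
split.
- by move=> u r cr _; apply: (congruence_refl cr).
- by move=> u v uv r cr gr; apply: (congruence_sym cr); apply: uv.
- move=> u v w uv vw r cr gr.
  by apply: (congruence_trans cr) (uv r cr gr) (vw r cr gr).
- move=> u u' v v' uu' vv' r cr gr.
  by apply: (congruence_add cr) (uu' r cr gr) (vv' r cr gr).
- by move=> a u v uv r cr gr; apply: (congruence_scale cr); apply: uv.
Qed.

Definition congr_rel : rel V := fun u v => `[< generated_congruence u v >].

Lemma congr_rel_equiv : equiv_class_of congr_rel.
Proof.
have cP := generated_congruenceP; split.
- by move=> u; apply/asboolP; apply: (congruence_refl cP).
- by move=> u v; apply: asbool_equiv_eq; split; apply: (congruence_sym cP).
- move=> v u w /asboolP uv /asboolP vw; apply/asboolP.
  exact: (congruence_trans cP) uv vw.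
Qed.

Canonical congr_equiv := EquivRelPack congr_rel_equiv.

Definition quotient_module := {eq_quot congr_equiv}.
HB.instance Definition _ := Choice.on quotient_module.
HB.instance Definition _ := EqQuotient.on quotient_module.

Lemma quotient_moduleP (u v : V) :
  \pi_quotient_module u = \pi_quotient_module v <-> generated_congruence u v.
Proof. by split=> [/eqmodP/asboolP//|uv]; apply/eqmodP/asboolP. Qed.

Let repP u : generated_congruence (repr (\pi_quotient_module u)) u.
Proof. by apply/quotient_moduleP; rewrite reprK. Qed.

Definition quot_add (p q : quotient_module) : quotient_module :=
  \pi_quotient_module (repr p + repr q).
Definition quot_scale (a : Rmax R) (p : quotient_module) : quotient_module :=
  \pi_quotient_module (a *: repr p).

Lemma quot_addE u v :
  quot_add (\pi_quotient_module u) (\pi_quotient_module v) = \pi_quotient_module (u + v).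
Proof.
by apply/quotient_moduleP; apply: (congruence_add generated_congruenceP);
  apply: repP.
Qed.

Lemma quot_scaleE a u :
  quot_scale a (\pi_quotient_module u) = \pi_quotient_module (a *: u).
Proof.
by apply/quotient_moduleP; apply: (congruence_scale generated_congruenceP);
  apply: repP.
Qed.

Let quotW (P : quotient_module -> Prop) : (forall u, P (\pi_quotient_module u)) -> forall p, P p.
Proof. by move=> Pu p; rewrite -[p]reprK; apply: Pu. Qed.

Let addA : associative quot_add.
Proof.
elim/quotW=> u; elim/quotW=> v; elim/quotW=> w.
by rewrite !quot_addE addrA.
Qed.
Let addC : commutative quot_add.
Proof. by elim/quotW=> u; elim/quotW=> v; rewrite !quot_addE addrC. Qed.
Let add0 : left_id (\pi_quotient_module 0) quot_add.
Proof. by elim/quotW=> u; rewrite quot_addE add0r. Qed.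

HB.instance Definition _ := GRing.isNmodule.Build quotient_module addA addC add0.

Let scaleA a b p : quot_scale a (quot_scale b p) = quot_scale (a * b) p.
Proof. by elim/quotW: p => u; rewrite !quot_scaleE scalerA. Qed.
Let scale0 p : quot_scale 0 p = 0.
Proof. by elim/quotW: p => u; rewrite quot_scaleE scale0r. Qed.
Let scale1 : left_id 1 quot_scale.
Proof. by elim/quotW=> u; rewrite quot_scaleE scale1r. Qed.
Let scaleDr : right_distributive quot_scale +%R.
Proof.
move=> a; elim/quotW=> u; elim/quotW=> v.
by rewrite [LHS](congr1 (quot_scale a) (quot_addE u v)) !quot_scaleE scalerDr
  -quot_addE.
Qed.
Let scaleDl p : {morph quot_scale^~ p : a b / a + b}.
Proof. by elim/quotW: p => u a b; rewrite !quot_scaleE scalerDl -quot_addE. Qed.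

HB.instance Definition _ := GRing.Nmodule_isLSemiModule.Build
  (Rmax R) quotient_module scaleA scale0 scale1 scaleDr scaleDl.

End Quotient.

Section QModule.
Context {R : realType} {E : choiceType} (M : infinite_valuated_matroid R E).

(* The sums over E are sums of finitely supported families, circuits having
   finite support. *)
Definition bend_relation (u v : free_module R E) : Prop :=
  exists (c : E -> Rmax R) (x : E),
    [/\ circuit M c,
        u = \sum_(y \in [set: E]) c y *: free_gen R y &
        v = \sum_(y \in [set y | y != x]) c y *: free_gen R y].

Definition Qmod : lSemiModType (Rmax R) := quotient_module bend_relation.

End QModule.

(* Main.v *)
Require Import Defs.
From HB Require Import structures.
From mathcomp Require Import all_boot all_order all_algebra finmap generic_quotient.
From mathcomp Require Import boolp classical_sets functions cardinality fsbigop.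
From mathcomp Require Import reals constructive_ereal.

Set Implicit Arguments.
Unset Strict Implicit.
Unset Printing Implicit Defensive.

Import Order.TTheory GRing.Theory Num.Theory.
Local Open Scope classical_set_scope.
Local Open Scope ring_scope.
Local Open Scope quotient_scope.

(* The order of Q_M has a one-step description: a x <= sum_y g(y) y holds iff
   a <= g(x) or some circuit c has c(x) = a and c <= g off x, since eliminating
   circuits makes this relation transitive. Simplicity then makes the atoms of
   Q_M the multiples of the generators; weak covers are the sums u <= u + q with
   q a multiple of an atom, which is stable under translation; and torsion-freeness
   is a contraction argument over the finitely many circuits, up to scaling, with
   given support.

   Conversely, the circuits of M are the support-minimal nonzero families of
   coefficients satisfying all bend relations among the generators. This
   recovers M, up to projective equivalence, from Q_M and its atoms, and
   defines a matroid from any geometric module. In such a module, if an atom lies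
   below a finite sum of atoms, then semimodularity allows the coefficients of the
   sum to be made minimal one at a time, and the minimal sum is a circuit. *)

(** * Arithmetic of R_max and the order of a module *)

Section RmaxTheory.
Context {R : realType}.
Implicit Types a b c t h : Rmax R.

Lemma rmax_addE a b : a + b = Order.max a b.
Proof.
by apply/val_inj; rewrite /= /Order.max -ltEsub; case: ifP.
Qed.

Lemma rmax_addxx a : a + a = a.
Proof. by rewrite rmax_addE maxxx. Qed.

Lemma rmax_leP a b : (a <= b) <-> a + b = b.
Proof. by rewrite rmax_addE; split=> /max_idPr. Qed.

Lemma rmax_ge0 a : (0 : Rmax R) <= a.
Proof. by apply/rmax_leP; rewrite add0r. Qed.

Lemma rmax_le0 a : a <= 0 -> a = 0.
Proof. by move/rmax_leP; rewrite addr0. Qed.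

Lemma rmax_gt0 a : ((0 : Rmax R) < a) = (a != 0).
Proof. by rewrite lt_neqAle rmax_ge0 andbT eq_sym. Qed.

Lemma rmax_lt_neq0 a b : a < b -> b != 0.
Proof. by rewrite -rmax_gt0; apply: le_lt_trans (rmax_ge0 a). Qed.

Lemma rmax_neq0_le a b : a != 0 -> a <= b -> b != 0.
Proof. by rewrite -!rmax_gt0; apply: lt_le_trans. Qed.

Lemma rmax_le_add a b c : (a + b <= c) = (a <= c) && (b <= c).
Proof. by rewrite rmax_addE ge_max. Qed.

Lemma rmax_leDl a b : a <= a + b.
Proof. by rewrite rmax_addE le_max lexx. Qed.

Lemma rmax_leDr a b : b <= a + b.
Proof. by rewrite rmax_addE le_max lexx orbT. Qed.

Lemma rmax_addP a b : a + b = a \/ a + b = b.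
Proof. by rewrite rmax_addE; case: leP; [right|left]. Qed.

Definition rmax_inv a : Rmax R :=
  if val a is r%:E then @MkRmax R (- r)%:E isT else 0.

Lemma rmax_mulV a : a != 0 -> a * rmax_inv a = 1.
Proof.
case: a => [[r| |] ra] a0; [|by have := ra|by case/eqP: a0; apply: val_inj].
by apply/val_inj; rewrite /= -EFinD subrr.
Qed.

Lemma rmax_mulVr a : a != 0 -> rmax_inv a * a = 1.
Proof. by rewrite mulrC; apply: rmax_mulV. Qed.

Lemma rmax_mulf_neq0 a b : a != 0 -> b != 0 -> a * b != 0.
Proof.
move=> a0 b0; apply/eqP => ab0.
by move: b0; rewrite -[b]mul1r -(rmax_mulVr a0) -mulrA ab0 mulr0 eqxx.
Qed.

Lemma rmax_inv_neq0 a : a != 0 -> rmax_inv a != 0.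
Proof.
move=> a0; apply/eqP => i0; have := rmax_mulV a0.
by rewrite i0 mulr0 => /(congr1 (@rmax_val R)).
Qed.

Lemma rmax_le_mul c a b : a <= b -> c * a <= c * b.
Proof. by move=> /rmax_leP ab; apply/rmax_leP; rewrite -mulrDr ab. Qed.

Lemma rmax_le_mulr c a b : a <= b -> a * c <= b * c.
Proof. by rewrite ![_ * c]mulrC; apply: rmax_le_mul. Qed.

Lemma rmax_le1_mul t a : t <= 1 -> t * a <= a.
Proof. by move=> /(rmax_le_mulr a); rewrite mul1r. Qed.

Lemma rmax_divP a b : a <= b -> exists2 t : Rmax R, t <= 1 & a = t * b.
Proof.
move=> ab; have [b0|b0] := eqVneq b 0.
  exists 0; first exact: rmax_ge0.
  by rewrite mul0r; apply: rmax_le0; rewrite -b0.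
exists (a * rmax_inv b); last by rewrite -mulrA rmax_mulVr ?mulr1.
by rewrite -(rmax_mulV b0) rmax_le_mulr.
Qed.

Lemma rmax_ltdivP a b : a < b -> exists2 t : Rmax R, t < 1 & a = t * b.
Proof.
move=> ab; have [t t1 e] := rmax_divP (ltW ab); exists t => //.
rewrite lt_neqAle t1 andbT; apply: contra_ltN ab => /eqP t1'.
by rewrite e t1' mul1r.
Qed.

(** For nonzero [t] and [h], the real value of [t ^+ n * h] is [r *+ n + s] with [r < 0]. *)
Lemma rmax_archimedean t h c : t < 1 -> c != 0 -> exists n, t ^+ n * h < c.
Proof.
move=> t1; rewrite -rmax_gt0 => c0.
have [->|t0] := eqVneq t 0; first by exists 1%N; rewrite expr1 mul0r.
have [->|h0] := eqVneq h 0; first by exists 0%N; rewrite mulr0.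
have fin (a : Rmax R) : (0 : Rmax R) < a -> exists r : R, val a = r%:E.
  by case: a => [[r| |] ?] //; exists r.
have [|r tr] := fin t; first by rewrite rmax_gt0.
have [|s hs] := fin h; first by rewrite rmax_gt0.
have [u cu] := fin c c0.
have trn n : val (t ^+ n) = (r *+ n)%:E.
  elim: n => [|n IH]; first by rewrite expr0 mulr0n.
  by rewrite exprS mulrS EFinD -IH -tr.
have r0 : 0 < - r.
  by rewrite oppr_gt0 -lte_fin -tr; exact: t1.
have [n nP] : exists n : nat, s - u < n%:R * (- r).
  exists (Num.truncn ((s - u) / - r)).+1; rewrite -ltr_pdivrMr //.
  exact: truncnS_gt.
exists n.
rewrite ltEsub [X in (X < _)%O](_ : _ = (val (t ^+ n)%R + val h)%E) //.
rewrite trn hs cu -EFinD lte_fin.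
rewrite mulrN mulr_natl in nP.
by rewrite -ltrBrDr -[X in X < _]opprK ltrNl opprB.
Qed.

End RmaxTheory.

Section ModuleOrder.
Context {R : realType} {N : lSemiModType (Rmax R)}.
Implicit Types (x y z w p q : N) (a b : Rmax R).

Lemma maddxx x : x + x = x.
Proof. by rewrite -[x]scale1r -scalerDl rmax_addxx. Qed.

Lemma mle_refl x : mle x x. Proof. exact: maddxx. Qed.
Hint Resolve mle_refl : core.

Lemma mle_trans y x z : mle x y -> mle y z -> mle x z.
Proof. by rewrite /mle => xy yz; rewrite -yz addrA xy. Qed.

Lemma mle_anti x y : mle x y -> mle y x -> x = y.
Proof. by rewrite /mle => xy; rewrite addrC xy. Qed.

Lemma mle0x x : mle 0 x. Proof. exact: add0r. Qed.
Hint Resolve mle0x : core.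

Lemma mlex0 x : mle x 0 -> x = 0.
Proof. by move=> x0; apply: mle_anti. Qed.

Lemma mle_addl x y : mle x (x + y).
Proof. by rewrite /mle addrA maddxx. Qed.
Lemma mle_addr x y : mle y (x + y).
Proof. by rewrite addrC; apply: mle_addl. Qed.
Hint Resolve mle_addl mle_addr : core.

Lemma mle_add x y z : mle (x + y) z <-> mle x z /\ mle y z.
Proof.
split=> [h|[xz yz]]; first by split; apply: mle_trans h.
by rewrite /mle -addrA yz.
Qed.

Lemma mleD x x' y y' : mle x x' -> mle y y' -> mle (x + y) (x' + y').
Proof.
by move=> h h'; apply/mle_add; split; [apply: mle_trans h _|apply: mle_trans h' _].
Qed.

Lemma mleZ a x y : mle x y -> mle (a *: x) (a *: y).
Proof. by rewrite /mle -scalerDr => ->. Qed.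

Lemma mleZr a b x : a <= b -> mle (a *: x) (b *: x).
Proof. by move/rmax_leP; rewrite /mle -scalerDl => ->. Qed.

Lemma mleZ1 a x : a <= 1 -> mle (a *: x) x.
Proof. by move=> /(mleZr x); rewrite scale1r. Qed.

Lemma mleZV a x y : a != 0 -> mle (a *: x) (a *: y) -> mle x y.
Proof. by move=> a0 /(mleZ (rmax_inv a)); rewrite !scalerA rmax_mulVr // !scale1r. Qed.

Lemma scaler_rmaxI a x y : a != 0 -> a *: x = a *: y -> x = y.
Proof.
by move=> a0 e; apply: mle_anti; apply: (mleZV a0); rewrite e.
Qed.

Lemma mle_sum (I : eqType) (s : seq I) (F : I -> N) z :
  {in s, forall i, mle (F i) z} -> mle (\sum_(i <- s) F i) z.
Proof.
elim: s => [|i s IH] H; rewrite ?big_nil ?big_cons //.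
apply/mle_add; split; first by apply: H; rewrite inE eqxx.
by apply: IH => j js; apply: H; rewrite inE js orbT.
Qed.

(** Since [a *: x] lies below [x], a weak cover of [x] by [x + p] can be tested with multiples of
    [p] alone. *)
Lemma add_absorb x p a : a <= 1 -> x + a *: (x + p) = x + a *: p.
Proof.
move=> a1; rewrite scalerDr addrA; congr (_ + _).
by rewrite addrC; apply: mleZ1.
Qed.

Lemma atom_scale x a : a != 0 -> atom x -> atom (a *: x).
Proof.
move=> a0 [_ [h1 h2 h3]]; split=> //; split.
- move=> t /= t1; split=> //; rewrite add0r; exact: mleZ1.
- move=> s t s1 t1 /=; rewrite !add0r !scalerA ![_ * a]mulrC -!scalerA.
  by move=> /(scaler_rmaxI a0) e; apply: h2; rewrite // !add0r.
- move=> z [_ za]; have : minterval 0 x (rmax_inv a *: z).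
    by split=> //; apply: (mleZV a0); rewrite scalerA rmax_mulV ?scale1r.
  move=> /h3[t t1] e; exists t => //; rewrite add0r.
  rewrite add0r in e; rewrite scalerA [t * a]mulrC -scalerA e.
  by rewrite scalerA rmax_mulV ?scale1r.
Qed.

Lemma atom_neq0 x : atom x -> x != 0.
Proof.
move=> [_ [_ h _]]; apply/eqP => x0.
have /(congr1 (@rmax_val R)) // : (0 : Rmax R) = 1.
apply: h; rewrite ?inE /Oset /= ?x0 ?scaler0 //; exact: rmax_ge0.
Qed.

Lemma mle_atom x z : atom x -> mle z x -> exists2 a : Rmax R, a <= 1 & z = a *: x.
Proof.
move=> [_ [_ _ h]] zx; have [//|a a1 /= <-] := h z.
by exists a => //; rewrite add0r.
Qed.

Lemma weakly_covers0_atom p : atom p -> weakly_covers 0 p.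
Proof.
move=> pa; split=> // z [_ zp]; have [a a1 ->] := mle_atom pa zp.
by exists a => //; rewrite add0r.
Qed.

End ModuleOrder.

#[export] Hint Resolve mle_refl mle0x mle_addl mle_addr : core.

(** * Free modules and circuits *)

Section FreeModuleTheory.
Context {R : realType} {E : choiceType}.
Implicit Types (f g h : free_module R E) (x y z : E) (a b t : Rmax R).

Lemma fcoefD f g x : (f + g) x = f x + g x.
Proof. exact: free_addE. Qed.
Lemma fcoefZ a f x : (a *: f) x = a * f x.
Proof. exact: free_scaleE. Qed.
Lemma fcoef0 x : (0 : free_module R E) x = 0.
Proof. exact: fsfun0E. Qed.
Lemma fcoef_gen x y : free_gen R x y = if y == x then 1 else 0.
Proof. by rewrite fsfun_fun in_fset1. Qed.

Definition free_of (S : {fset E}) (eta : E -> Rmax R) : free_module R E :=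
  [fsfun x in S => eta x | 0].

Lemma free_ofE (S : {fset E}) (eta : E -> Rmax R) :
  (forall x, eta x != 0 -> x \in S) -> free_of S eta =1 eta.
Proof.
move=> h x; rewrite fsfun_fun; case: ifPn => // xS.
by apply/esym/eqP; apply: contraNT xS; apply: h.
Qed.

(** With [t = 0] this deletes the coordinate [y]; sums over all points but one are written this
    way. *)
Definition upd f y t : free_module R E :=
  free_of (y |` finsupp f)%fset (fun x => if x == y then t else f x).

Lemma updE f y t x : upd f y t x = if x == y then t else f x.
Proof.
rewrite free_ofE // => z; rewrite in_fset1U mem_finsupp.
by case: (z == y).
Qed.

Lemma free_eq f g : (forall x, f x = g x) -> f = g.
Proof. by move=> h; apply/fsfunP. Qed.

Lemma free_leP f g : (forall x, f x <= g x) <-> f + g = g.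
Proof.
split=> [h|<- x]; last by rewrite fcoefD rmax_leDl.
by apply: free_eq => x; rewrite fcoefD; apply/rmax_leP.
Qed.

Lemma free_neq0 f : f != 0 -> exists x, f x != 0.
Proof.
move=> f0; apply: contrapT => h; case/eqP: f0; apply: free_eq => x.
by rewrite fcoef0; apply: contrapT => /eqP fx; apply: h; exists x.
Qed.

Section Evaluation.
Context {N : lSemiModType (Rmax R)}.
Variable p : E -> N.

Definition ev f : N := \sum_(y <- finsupp f) f y *: p y.

Lemma ev_widen (S : {fset E}) f : (forall x, f x != 0 -> x \in S) ->
  ev f = \sum_(y <- S) f y *: p y.
Proof.
move=> fS; rewrite /ev (big_fset_incl _ (B := S)) //.
  by apply/fsubsetP => x; rewrite mem_finsupp; apply: fS.
by move=> x _ /fsfun_dflt ->; rewrite scale0r.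
Qed.

Lemma ev_is_semilinear : semilinear ev.
Proof.
split=> [a f|f g].
  rewrite (ev_widen (S := finsupp f)) => [|x]; last first.
    by rewrite mem_finsupp fcoefZ; apply: contra_neq => ->; rewrite mulr0.
  by rewrite /ev scaler_sumr; apply: eq_bigr => y _; rewrite fcoefZ scalerA.
pose S := (finsupp f `|` finsupp g)%fset.
have fS x : f x != 0 -> x \in S by rewrite in_fsetU mem_finsupp => ->.
have gS x : g x != 0 -> x \in S by rewrite in_fsetU !mem_finsupp orbC => ->.
rewrite (ev_widen fS) (ev_widen gS) (ev_widen (S := S)) => [|x].
  by rewrite -big_split; apply: eq_bigr => y _; rewrite fcoefD scalerDl.
rewrite fcoefD => fg0; apply: contrapT => xS; case/eqP: fg0.
case: (eqVneq (f x) 0) => [->|/fS//]; case: (eqVneq (g x) 0) => [->|/gS//].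
by rewrite addr0.
Qed.

HB.instance Definition _ := GRing.isSemilinear.Build (Rmax R) (free_module R E) N
  *:%R ev ev_is_semilinear.

Lemma evD f g : ev (f + g) = ev f + ev g. Proof. exact: linearD. Qed.
Lemma evZ a f : ev (a *: f) = a *: ev f. Proof. exact: linearZ. Qed.
Lemma ev0 : ev 0 = 0. Proof. exact: linear0. Qed.

Lemma ev_gen x : ev (free_gen R x) = p x.
Proof.
rewrite (ev_widen (S := [fset x]%fset)) => [|y].
  by rewrite big_seq_fset1 fcoef_gen eqxx scale1r.
by rewrite fcoef_gen in_fset1; case: ifP => //; rewrite eqxx.
Qed.

Lemma ev_upd f x t : ev (upd f x t) = t *: p x + ev (upd f x 0).
Proof.
rewrite -ev_gen -evZ -evD; congr ev; apply: free_eq => y.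
rewrite !(fcoefD, fcoefZ, updE, fcoef_gen); case: eqP => _.
  by rewrite mulr1 addr0.
by rewrite mulr0 add0r.
Qed.

Lemma upd_id f x : upd f x (f x) = f.
Proof. by apply: free_eq => y; rewrite updE; case: eqP => // ->. Qed.

Lemma ev_split f x : ev f = f x *: p x + ev (upd f x 0).
Proof. by rewrite -ev_upd upd_id. Qed.

Lemma ev_mono f g : (forall x, f x <= g x) -> mle (ev f) (ev g).
Proof. by move=> /free_leP fg; rewrite /mle -evD fg. Qed.

Lemma ev_term f x : mle (f x *: p x) (ev f).
Proof. by rewrite (ev_split f x). Qed.

Lemma ev_le f (w : N) :
  (forall x, f x != 0 -> mle (f x *: p x) w) -> mle (ev f) w.
Proof. by move=> h; apply: mle_sum => x; rewrite mem_finsupp; apply: h. Qed.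

End Evaluation.

Lemma linear_ev (N N' : lSemiModType (Rmax R)) (F : {linear N -> N'})
  (p : E -> N) f : F (ev p f) = ev (fun x => F (p x)) f.
Proof. by rewrite /ev linear_sum; apply: eq_bigr => y _; rewrite linearZ. Qed.

Lemma ev_free_gen f : ev (@free_gen R E) f = f.
Proof.
apply: free_eq => x; rewrite (ev_split _ _ x) fcoefD fcoefZ fcoef_gen eqxx mulr1.
suff -> : ev (@free_gen R E) (upd f x 0) x = 0 by rewrite addr0.
have evx h : h x = 0 -> ev (@free_gen R E) h x = 0.
  move=> hx; rewrite /ev; elim/big_rec: _ => [|y k _ k0]; first exact: fcoef0.
  rewrite fcoefD k0 addr0 fcoefZ fcoef_gen; case: eqP => [<-|_].
    by rewrite hx mul0r.
  by rewrite mulr0.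
by apply: evx; rewrite updE eqxx.
Qed.

End FreeModuleTheory.

(** * Circuit systems and dependence *)

Section CircuitSystems.
Context {R : realType} {E : choiceType}.
Implicit Types (C : set (free_module R E)) (f g h X Y Z c d : free_module R E).
Implicit Types (x y z u v e : E) (a b t : Rmax R).

(** The circuit axioms are stated on all of [E], so that circuits of different finite restrictions
    can be combined directly. *)
Record circuit_system C : Prop := CircuitSystem {
  cs_nonzero : ~ C 0;
  cs_incomparable : forall X Y, C X -> C Y ->
    (forall e, X e != 0 -> Y e != 0) -> forall e, Y e != 0 -> X e != 0;
  cs_scale : forall X a, C X -> a != 0 -> C (a *: X);
  cs_elimination : forall X Y u v, C X -> C Y ->
    X u = Y u -> X u != 0 -> Y v < X v ->
    exists Z, [/\ C Z, Z u = 0, Z v = X v & forall e, Z e <= X e + Y e]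
}.

Definition cs_simple C : Prop :=
  forall X, C X -> forall x y, exists z, [/\ z != x, z != y & X z != 0].

Definition dependent C g a x : Prop :=
  a <= g x \/ exists c, [/\ C c, c x = a & forall y, y != x -> c y <= g y].

Definition dominated C f g : Prop := forall x, dependent C g (f x) x.

Variable C : set (free_module R E).
Hypothesis csC : circuit_system C.

(** If [X v > Y v], eliminating [u] gives a circuit whose support lies in that of [X] but misses
    [u], against incomparability. *)
Lemma circuit_determined X Y u : C X -> C Y ->
  (forall e, (X e != 0) = (Y e != 0)) -> X u != 0 -> X u = Y u -> X = Y.
Proof.
have le X' Y' : C X' -> C Y' -> (forall e, (X' e != 0) = (Y' e != 0)) ->
  X' u != 0 -> X' u = Y' u -> forall v, X' v <= Y' v.
  move=> CX CY XY Xu0 XYu v; rewrite leNgt; apply/negP => lt.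
  have [Z [CZ Zu Zv Zle]] := cs_elimination csC CX CY XYu Xu0 lt.
  suff : Z u != 0 by rewrite Zu eqxx.
  apply: (cs_incomparable csC CZ CX) => // e Ze.
  apply: contrapT => /negP; rewrite negbK => Xe.
  have Ye : Y' e == 0 by apply/negPn; rewrite -XY Xe.
  case/eqP: Ze; apply: rmax_le0; apply: le_trans (Zle e) _.
  by rewrite (eqP Xe) (eqP Ye) addr0.
move=> CX CY XY Xu0 XYu; apply: free_eq => v; apply: le_anti.
by apply/andP; split; apply: le => //; rewrite -XYu.
Qed.

(** A witnessing circuit is scaled by [b / a]. Scaling by 0 gives no circuit, but for [b = 0] the
    first alternative holds. *)
Lemma dependent_le g a b x : b <= a -> dependent C g a x -> dependent C g b x.
Proof.
move=> ba [ax|[c [Cc ca cg]]]; first by left; apply: le_trans ba ax.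
have [b0|b0] := eqVneq b 0; first by left; rewrite b0 rmax_ge0.
right; have [t t1 bt] := rmax_divP ba.
exists (t *: c); split.
- by apply: (cs_scale csC) => //; apply: contra_neq b0; rewrite bt => ->; rewrite mul0r.
- by rewrite fcoefZ ca bt.
- by move=> y yx; rewrite fcoefZ; apply: le_trans (cg y yx); apply: rmax_le1_mul.
Qed.

(* Eliminate one after the other the elements [y] where the circuit exceeds
   [f], using a circuit that witnesses the dependence of [g y] on [f]. *)
Lemma dependent_trans f g a x :
  dominated C g f -> dependent C g a x -> dependent C f a x.
Proof.
move=> gf [ax|[c [Cc ca cg]]]; first exact: dependent_le ax (gf x).
suff H (s : seq E) : forall c, C c -> c x = a ->
    (forall y, y != x -> c y <= f y \/ (y \in s /\ c y <= g y)) ->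
    dependent C f a x.
  apply: (H (finsupp c) c) => // y yx.
  have [yc|yc] := boolP (y \in finsupp c); first by right; split=> //; apply: cg.
  by left; rewrite (fsfun_dflt yc); apply: rmax_ge0.
elim: s => [|y s IH] {}c {}Cc {}ca {}cg.
  by right; exists c; split=> // y /cg[//|[]].
have [cfy|cfy] := boolP ((y == x) || (c y <= f y)).
  apply: (IH c) => // z zx; have [|[]] := cg z zx; first by left.
  rewrite inE => /orP[/eqP zy|zs] cgz; last by right.
  by left; move: cfy; rewrite -zy (negbTE zx).
move: cfy; rewrite negb_or -ltNge => /andP[yx fcy].
have cgy : c y <= g y.
  by have [|[]//] := cg y yx; rewrite leNgt fcy.
have := dependent_le cgy (gf y); case=> [|[d [Cd dy df]]].
  by rewrite leNgt fcy.
(* [d] agrees with [c] at [y] and is below [f] elsewhere. Either it already shows [a <= f x], or [y]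
   can be eliminated while the value at [x] is kept. *)
have [cdx|dcx] := leP (c x) (d x).
  by left; rewrite -ca; apply: le_trans cdx (df _ _); rewrite eq_sym.
have [|Z [CZ Zy Zx Zle]] := cs_elimination csC Cc Cd (esym dy) _ dcx.
  exact: rmax_lt_neq0 fcy.
apply: (IH Z) => //; first by rewrite Zx.
move=> z zx; have [->|zy] := eqVneq z y; first by left; rewrite Zy rmax_ge0.
have := Zle z; case: (rmax_addP (c z) (d z)) => -> Zz; last first.
  by left; apply: le_trans Zz (df _ zy).
have [czf|[]] := cg z zx; first by left; apply: le_trans Zz czf.
rewrite inE (negbTE zy) /= => zs czg; right; split=> //.
exact: le_trans Zz czg.
Qed.

Lemma dominated_le f g : (forall x, f x <= g x) -> dominated C f g.
Proof. by move=> fg x; left. Qed.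

Lemma dominated_trans f g h :
  dominated C f g -> dominated C g h -> dominated C f h.
Proof. by move=> fg gh x; apply: dependent_trans (fg x). Qed.

Lemma dominatedD f g h :
  dominated C f h -> dominated C g h -> dominated C (f + g) h.
Proof. by move=> fh gh x; rewrite fcoefD; case: (rmax_addP (f x) (g x)) => ->. Qed.

Lemma dominatedZ a f g : dominated C f g -> dominated C (a *: f) (a *: g).
Proof.
move=> fg x; rewrite fcoefZ; have [->|a0] := eqVneq a 0.
  by left; rewrite mul0r rmax_ge0.
have [le|[c [Cc cx cg]]] := fg x.
  by left; rewrite fcoefZ rmax_le_mul.
right; exists (a *: c); split; first exact: cs_scale.
  by rewrite fcoefZ cx.
by move=> y yx; rewrite !fcoefZ rmax_le_mul // cg.
Qed.

End CircuitSystems.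

(** * Modules presented by circuits *)

Section Presentations.
Context {R : realType} {E : choiceType} {N : lSemiModType (Rmax R)}.
Implicit Types (C : set (free_module R E)) (f g h c : free_module R E).
Implicit Types (x y z e : E) (a b t : Rmax R) (u v w q : N).

(** An interface for [Q_M] and its generators that also fits rescaled generators and geometric
    modules. *)
Record presents C (p : E -> N) : Prop := Presents {
  presents_surj : forall v, exists f, v = ev p f;
  presents_le : forall f g, mle (ev p f) (ev p g) <-> dominated C f g
}.

(** A transversal of the atoms modulo nonzero scalars. *)
Record atom_basis (p : E -> N) : Prop := AtomBasis {
  basis_atom : forall x, atom (p x);
  basis_inj : forall x y a b, a != 0 -> a *: p x = b *: p y -> x = y;
  basis_surj : forall q, atom q -> exists x a, a != 0 /\ q = a *: p x
}.

(** The bend equation at [x] holds exactly when the term at [x] is absorbed by the sum of the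
    others; hence the inequality. *)
Definition bend (p : E -> N) f : Prop :=
  forall x, mle (f x *: p x) (ev p (upd f x 0)).

Definition minimal_bend (p : E -> N) f : Prop :=
  [/\ f != 0, bend p f &
      forall g, g != 0 -> bend p g -> (forall e, g e != 0 -> f e != 0) ->
        forall e, f e != 0 -> g e != 0].

Variables (C : set (free_module R E)) (p : E -> N).
Hypotheses (csC : circuit_system C) (pC : presents C p).

Lemma mle_evP a x g : mle (a *: p x) (ev p g) <-> dependent C g a x.
Proof.
rewrite -[p x]ev_gen -evZ; split=> [/(presents_le pC)/(_ x)|h].
  by rewrite fcoefZ fcoef_gen eqxx mulr1.
apply/(presents_le pC) => y; rewrite fcoefZ fcoef_gen; case: eqP => [->|_].
  by rewrite mulr1.
by rewrite mulr0; left; apply: rmax_ge0.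
Qed.

Lemma circuit_bend c : C c -> bend p c.
Proof.
move=> Cc x; apply/mle_evP; right; exists c; split=> // y yx.
by rewrite updE (negbTE yx).
Qed.

(** Applied at every point of the support, this exhibits a bend as a pointwise maximum of
    circuits. *)
Lemma circuit_below_bend f x : bend p f -> f x != 0 ->
  exists c, [/\ C c, c x = f x & forall y, c y <= f y].
Proof.
move=> /(_ x)/mle_evP[|[c [Cc cx cf]] fx]; rewrite ?updE ?eqxx.
  by move=> /rmax_le0->; rewrite eqxx.
exists c; split=> // y; have [->|yx] := eqVneq y x; first by rewrite cx.
by have := cf y yx; rewrite updE (negbTE yx).
Qed.

(** The circuits below a minimal bend that touch it at the points of its support all have its full
    support. They are therefore proportional, and comparing them shows that one of them is the whole
    bend. The characterization by [p] alone is what recovers the circuits from the module. *)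
Lemma circuit_minimal_bend f : C f <-> minimal_bend p f.
Proof.
split=> [Cf|[f0 bf fmin]].
  split; first by apply/eqP => f0; apply: (cs_nonzero csC); rewrite -f0.
    exact: circuit_bend.
  move=> g g0 bg gf; have [x gx] := free_neq0 g0.
  have [c [Cc cx cg]] := circuit_below_bend bg gx.
  move=> e fe; apply: (rmax_neq0_le _ (cg e)).
  apply: (cs_incomparable csC Cc Cf) => // y cy.
  by apply: gf; apply: rmax_neq0_le cy (cg y).
have circ_supp c : C c -> (forall y, c y <= f y) ->
    forall e, (c e != 0) = (f e != 0).
  move=> Cc cf e; apply/idP/idP => [ce|]; first exact: rmax_neq0_le ce (cf e).
  apply: fmin; [|exact: circuit_bend|by move=> y cy; apply: rmax_neq0_le cy (cf y)].
  by apply/eqP => c0; apply: (cs_nonzero csC); rewrite -c0.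
have [x fx] := free_neq0 f0.
have [c [Cc cx cf]] := circuit_below_bend bf fx.
suff -> : f = c by [].
apply: free_eq => y; apply: le_anti; rewrite cf andbT.
have [->|fy] := eqVneq (f y) 0; first exact: rmax_ge0.
have [d [Cd dy df]] := circuit_below_bend bf fy.
have cy0 : c y != 0 by rewrite circ_supp.
(* [c] and [d] have the same support, so they coincide once [c] is rescaled to agree with [d] at
   [y]. *)
have [k k0 dk] : exists2 k : Rmax R, k != 0 & k *: c = d.
  exists (d y * rmax_inv (c y)).
    by rewrite rmax_mulf_neq0 ?rmax_inv_neq0 // dy.
  have k0 : d y * rmax_inv (c y) != 0.
    by rewrite rmax_mulf_neq0 ?rmax_inv_neq0 // dy.
  have e1 e : ((d y * rmax_inv (c y) *: c) e != 0) = (d e != 0).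
    rewrite fcoefZ (circ_supp d) // -(circ_supp c) //.
    apply/idP/idP => [|ce]; last exact: rmax_mulf_neq0.
    by apply: contra_neq => ->; rewrite mulr0.
  apply: (circuit_determined csC (u := y)) => //.
  - exact: cs_scale.
  - by rewrite e1 dy.
  - by rewrite fcoefZ -mulrA rmax_mulVr // mulr1.
(* [c] touches [f] at [x], so [d <= f] there forces [k <= 1], whence [f y = d y <= c y]. *)
have := df x; rewrite -dk fcoefZ -cx => kc.
have k1 : k <= 1.
  have := rmax_le_mulr (rmax_inv (c x)) kc.
  by rewrite -mulrA !rmax_mulV ?mulr1 // cx.
by rewrite -dy -dk fcoefZ; apply: rmax_le1_mul.
Qed.

Hypothesis simpleC : cs_simple C.

(** A witnessing circuit would be supported on [x] and [y], which simplicity forbids, so only the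
    comparison of coefficients is left. *)
Lemma mle_scaled_gen a x b y :
  a != 0 -> mle (a *: p x) (b *: p y) -> x = y /\ a <= b.
Proof.
move=> a0; rewrite -[p y]ev_gen -evZ => /mle_evP[|[c [Cc cx cg]]].
  rewrite fcoefZ fcoef_gen; case: eqP => [->|_]; first by rewrite mulr1.
  by rewrite mulr0 => /rmax_le0 a0'; rewrite a0' eqxx in a0.
have [z [zx zy cz]] := simpleC Cc x y.
have := cg z zx; rewrite fcoefZ fcoef_gen (negbTE zy) mulr0.
by move=> /rmax_le0 cz0; rewrite cz0 eqxx in cz.
Qed.

Lemma scaled_gen_inj a b x : a *: p x = b *: p x -> a = b.
Proof.
have le a' b' : a' *: p x = b' *: p x -> a' <= b'.
  move=> e; have [->|a0] := eqVneq a' 0; first exact: rmax_ge0.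
  by have [|_ //] := mle_scaled_gen (x := x) (y := x) (b := b') a0; rewrite -e.
by move=> e; apply: le_anti; rewrite !le.
Qed.

(** The terms of a combination below [p x] are themselves below [p x], so by [mle_scaled_gen] only
    the term at [x] survives. *)
Lemma presents_gen_atom x : atom (p x).
Proof.
split=> //; split.
- by move=> a a1 /=; split=> //; rewrite add0r; apply: mleZ1.
- by move=> a b _ _; rewrite !add0r; apply: scaled_gen_inj.
move=> v [_ vx]; have [f vf] := presents_surj pC v.
have fx y : f y != 0 -> y = x /\ f y <= 1.
  move=> fy; apply: mle_scaled_gen; rewrite // scale1r.
  by apply: mle_trans vx; rewrite vf; apply: ev_term.
have f1 : f x <= 1.
  by have [->|/fx[]//] := eqVneq (f x) 0; apply: rmax_ge0.
exists (f x) => //=; rewrite add0r vf (ev_split p f x).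
suff -> : upd f x 0 = 0 by rewrite ev0 addr0.
apply: free_eq => y; rewrite updE fcoef0; case: eqP => // yx.
by apply: contrapT => /eqP/fx[].
Qed.

Lemma presents_atom_basis : atom_basis p.
Proof.
split; first exact: presents_gen_atom.
  by move=> x y a b a0 e; have [|//] := mle_scaled_gen (x := x) (y := y) (b := b) a0;
    rewrite -e.
move=> q qa; have [f qf] := presents_surj pC q.
have f0 : f != 0.
  by apply/eqP => f0; have := atom_neq0 qa; rewrite qf f0 ev0 eqxx.
have [x fx] := free_neq0 f0.
have [a a1 e] : exists2 a : Rmax R, a <= 1 & f x *: p x = a *: q.
  by apply: mle_atom => //; rewrite qf; apply: ev_term.
have a0 : a != 0.
  apply/eqP => a0; move: e; rewrite a0 scale0r -(scaler0 _ (f x)).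
  move=> /(scaler_rmaxI fx) px0.
  by have := atom_neq0 (presents_gen_atom x); rewrite px0 eqxx.
exists x, (rmax_inv a * f x); split.
  by rewrite rmax_mulf_neq0 ?rmax_inv_neq0.
by rewrite -scalerA e scalerA rmax_mulVr // scale1r.
Qed.

Lemma presents_atomic : atomic N.
Proof.
move=> v; have [f ->] := presents_surj pC v.
exists [seq f y *: p y | y <- finsupp f]; split; last by rewrite big_map.
move=> _ /mapP[y yf ->]; apply: atom_scale; last exact: presents_gen_atom.
by rewrite mem_finsupp in yf.
Qed.

(** Serves to find one exponent that works for all supports inside a given finite set. *)
Lemma uniform_bound (I : eqType) (P : I -> nat -> Prop) (s : seq I) :
  (forall i, exists n, forall m, (n <= m)%N -> P i m) ->
  exists n, forall i m, i \in s -> (n <= m)%N -> P i m.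
Proof.
move=> h; elim: s => [|i s [n IH]]; first by exists 0%N.
have [k hk] := h i; exists (maxn n k) => j m; rewrite inE geq_max.
by move=> /orP[/eqP->|js] /andP[nm km]; [apply: hk|apply: IH].
Qed.

(* Iterating [w <= u + t w] gives [w <= u + t^n w] for all [n]. The circuits
   that witness these inequalities range over a finite set, because a
   normalized circuit is determined by its support, and [t^n] tends to 0. *)
Lemma absorb_contraction u w t : t < 1 -> mle w (u + t *: w) -> mle w u.
Proof.
move=> t1 wu.
have iter n : mle w (u + t ^+ n *: w).
  elim: n => [|n IH]; first by rewrite expr0 scale1r.
  apply: (mle_trans IH); apply/mle_add; split=> //.
  apply: (mle_trans (mleZ _ wu)); rewrite scalerDr scalerA -exprSr.
  apply: mleD => //; apply: mleZ1.
  by elim: n {IH} => [|n IH]; rewrite ?expr0 // exprS;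
    apply: le_trans (rmax_le1_mul _ (ltW t1)) IH.
have tmono n m a : (n <= m)%N -> t ^+ m * a <= t ^+ n * a.
  move=> /subnK <-; elim: (m - n)%N => [//|k IH].
  by rewrite addSn exprS -mulrA; apply: le_trans (rmax_le1_mul _ (ltW t1)) IH.
have [f uf] := presents_surj pC u; have [g wg] := presents_surj pC w.
rewrite wg; apply: ev_le => e ge0; rewrite uf; apply/mle_evP.
apply: contrapT => ndep.
have dep n : dependent C (f + t ^+ n *: g) (g e) e.
  apply/mle_evP; rewrite evD evZ /= -uf -wg.
  by apply: mle_trans (iter n); rewrite wg; apply: ev_term.
pose S := (e |` (finsupp f `|` finsupp g))%fset.
have := @uniform_bound _ (fun (A : {fset E}) n => forall c, C c ->
   c e = g e -> finsupp c = A ->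
   ~ (forall y, y != e -> c y <= f y + t ^+ n * g y)) (fpowerset S).
case=> [A|n0 n0P].
  have [[c [Cc ce cA]]|nc] := pselect (exists c, [/\ C c, c e = g e & finsupp c = A]);
    last by exists 0%N => m _ c Cc ce cA; case: nc; exists c.
  (* [c] is the only circuit with support [A] and value [g e] at [e]. It exceeds [f] at some [y]
     other than [e], and for large [n] the term [t ^+ n * g y] no longer makes up for this. *)
  have [y ye cy] : exists2 y, y != e & f y < c y.
    apply: contrapT => h; apply: ndep; right; exists c; split=> // y ye.
    by rewrite leNgt; apply/negP => lt; apply: h; exists y.
  have [n nP] := rmax_archimedean (g y) t1 (rmax_lt_neq0 cy).
  exists n => m nm d Cd de dA dle.
  have dc : d = c.
    apply: (circuit_determined csC Cd Cc (u := e)); rewrite ?de ?ce //.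
    move=> z; have := congr1 (fun B : {fset E} => z \in B) (etrans dA (esym cA)).
    by rewrite !mem_finsupp.
  have := dle y ye; rewrite dc leNgt rmax_addE gt_max.
  by rewrite cy (le_lt_trans (tmono _ _ _ nm) nP).
(* From [n1] on, [t ^+ n * g e] is less than [g e], which rules out the first alternative of
   dependence. *)
have [n1 n1P] := rmax_archimedean (g e) t1 ge0.
have := dep (maxn n0 n1); case=> [|[c [Cc ce cle]]].
  rewrite fcoefD fcoefZ => le.
  have : g e <= f e.
    move: le; case: (rmax_addP (f e) (t ^+ maxn n0 n1 * g e)) => -> // le.
    have := le_lt_trans (tmono n1 (maxn n0 n1) (g e) (leq_maxr _ _)) n1P.
    by rewrite ltNge le.
  by move=> ?; apply: ndep; left.
apply: (n0P (finsupp c) (maxn n0 n1) _ (leq_maxl _ _) c Cc ce erefl).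
  rewrite fpowersetE; apply/fsubsetP => y; rewrite mem_finsupp => cy.
  rewrite !inE; have [//|ye] := eqVneq y e.
  have := cle y ye; rewrite fcoefD fcoefZ /= => /(rmax_neq0_le cy).
  rewrite !mem_finsupp; apply: contraNT; rewrite negb_or !negbK.
  by move=> /andP[/eqP-> /eqP->]; rewrite mulr0 addr0.
by move=> y /cle; rewrite fcoefD fcoefZ.
Qed.

Lemma presents_strongly_torsion_free : strongly_torsion_free N.
Proof.
split=> [v a v0 a0|u v a b uv a1 b1 e].
  by apply: contra_neq v0 => av; apply: (scaler_rmaxI a0); rewrite av scaler0.
have main s t : s < t -> u + s *: v = u + t *: v ->
    u = u + s *: v /\ u = u + t *: v.
  move=> st est; suff h : mle (t *: v) u.
    by rewrite est; split; rewrite addrC h.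
  (* With [s = k * t], the element [t *: v] is below [u + k *: (t *: v)], so the contraction
     argument applies. *)
  have [k k1 sk] := rmax_ltdivP st.
  by apply: (absorb_contraction k1); rewrite scalerA -sk est.
have [ab|ba|->] := ltgtP a b; last by left.
- by right; apply: main.
- by right; have [] := main _ _ ba (esym e).
Qed.

Lemma weak_exchange u b y t e : mle (b *: p y) (u + t *: p e) ->
  exists2 a : Rmax R, a <= 1 & u + b *: p y = u + a *: (t *: p e).
Proof.
have [f uf] := presents_surj pC u.
have low : dependent C f b y ->
    exists2 a : Rmax R, a <= 1 & u + b *: p y = u + a *: (t *: p e).
  move=> /mle_evP h; exists 0; first exact: rmax_ge0.
  by rewrite scale0r addr0 addrC uf.
have coefe z : z != e -> (f + t *: free_gen R e) z = f z.
  by move=> ze; rewrite fcoefD fcoefZ fcoef_gen (negbTE ze) mulr0 addr0.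
rewrite {1}uf -{1}[p e]ev_gen -evZ -evD => /mle_evP.
have [->{y low}|ye] := eqVneq y e; last first.
  case=> [|[c [Cc cy cle]]]; first by rewrite coefe // => ?; apply: low; left.
  have := cle e; rewrite eq_sym ye => /(_ isT).
  rewrite fcoefD fcoefZ fcoef_gen eqxx mulr1.
  case: (rmax_addP (f e) t) => -> ce.
    apply: low; right; exists c; split=> // z zy.
    have [->//|ze] := eqVneq z e; by rewrite -(coefe z ze) cle.
  have [a a1 cat] := rmax_divP ce; exists a => //; rewrite scalerA -cat.
  have coef_le z (k : Rmax R) x : f z <= (f + k *: free_gen R x) z.
    by rewrite fcoefD rmax_leDl.
  have gen_le (k : Rmax R) x : k <= (f + k *: free_gen R x) x.
    by rewrite fcoefD fcoefZ fcoef_gen eqxx mulr1 rmax_leDr.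
  apply: mle_anti; apply/mle_add; split=> //.
    rewrite uf -[p e]ev_gen -evZ -evD; apply/mle_evP.
    right; exists c; split=> // z zy; have [->//|ze] := eqVneq z e.
    by apply: le_trans (cle z zy) _; rewrite coefe.
  rewrite uf -[p y]ev_gen -evZ -evD; apply/mle_evP.
  right; exists c; split=> // z ze; have [->|zy] := eqVneq z y.
    by rewrite cy.
  by apply: le_trans (cle z zy) _; rewrite coefe.
case=> [|[c [Cc ce cle]]]; last first.
  exists 0; first exact: rmax_ge0.
  rewrite scale0r addr0 addrC; rewrite uf; apply/mle_evP; right; exists c.
  by split=> // z ze; rewrite -(coefe z ze) cle.
rewrite fcoefD fcoefZ fcoef_gen eqxx mulr1; case: (rmax_addP (f e) t) => -> be.
  exists 0; first exact: rmax_ge0.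
  by rewrite scale0r addr0 addrC uf; apply/mle_evP; left.
by have [a a1 ->] := rmax_divP be; exists a; rewrite ?scalerA.
Qed.

(** Modulo [u], each term of an element of the interval becomes a multiple of [t *: p e] by
    [weak_exchange], and the scalars add up. *)
Lemma weakly_covers_add_gen u t e : weakly_covers u (u + t *: p e).
Proof.
split=> // v [uv vu]; have [g vg] := presents_surj pC v.
suff [a a1 ea] : exists2 a : Rmax R, a <= 1 & v = u + a *: (t *: p e).
  by exists a => //; rewrite add_absorb.
rewrite -[v]uv {1}vg /ev.
elim: (finsupp g : seq E) => [|y s [b b1 IH]].
  exists 0; first exact: rmax_ge0.
  by rewrite big_nil scale0r.
have [|a a1 ea] := @weak_exchange u (g y) y t e.
  by apply: mle_trans vu; rewrite vg; apply: ev_term.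
exists (a + b); first by rewrite rmax_le_add a1.
by rewrite big_cons -[in LHS](maddxx u) addrACA IH ea addrACA maddxx -scalerDl.
Qed.

(** Adding one term of [v] to [u] gives an element of the interval, of the form [u + b *: v].
    Scalars are totally ordered, so a term with the largest [b] already yields all of [v]. *)
Lemma weakly_covers_add_atom u v : weakly_covers u v ->
  exists q, v = u + q /\ (q = 0 \/ exists t e, q = t *: p e).
Proof.
move=> [uv cov]; have [g vg] := presents_surj pC v.
suff [q [a [a1 hs hq qat]]] : exists q (a : Rmax R), [/\ a <= 1,
    u + \sum_(y <- finsupp g) g y *: p y = u + a *: v,
    u + q = u + a *: v & (q = 0 \/ exists t e, q = t *: p e)].
  by exists q; rewrite hq -hs -[X in u + X]/(ev p g) -vg; split.
elim: (finsupp g : seq E) => [|y s [q [a [a1 hs hq qat]]]].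
  exists 0, 0; rewrite big_nil scale0r; split=> //; first exact: rmax_ge0.
  by left.
have [|b b1 hb] := cov (u + g y *: p y).
  by split=> //; apply/mle_add; split=> //; rewrite vg; apply: ev_term.
have hsum : u + \sum_(z <- y :: s) g z *: p z = u + (a + b) *: v.
  by rewrite big_cons addrA hb addrAC hs scalerDl addrA.
case: (rmax_addP a b) => ab; rewrite ab in hsum.
  by exists q, a.
exists (g y *: p y), b; split=> //.
by right; exists (g y), y.
Qed.

Lemma presents_semimodular : semimodular N.
Proof.
move=> u v w /weakly_covers_add_atom[q [-> [->|[t [e ->]]]]]; rewrite addrAC.
  rewrite addr0; split=> // z [h1 h2]; exists 0; first exact: rmax_ge0.
  by rewrite scale0r addr0; apply: mle_anti.
exact: weakly_covers_add_gen.
Qed.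

Lemma presents_geometric : geometric N.
Proof.
split; [exact: presents_atomic|exact: presents_semimodular|].
exact: presents_strongly_torsion_free.
Qed.

End Presentations.

(** Domination both ways is equality of combinations, so both modules are the quotient of the free
    module by the same relation. *)
Lemma presents_iso (R : realType) (E : choiceType) (N N' : lSemiModType (Rmax R))
    (C : set (free_module R E)) (p : E -> N) (p' : E -> N') :
  presents C p -> presents C p' -> module_iso N N'.
Proof.
move=> pC pC'.
pose F v := ev p' (projT1 (cid (presents_surj pC v))).
pose G v := ev p (projT1 (cid (presents_surj pC' v))).
have FE f : F (ev p f) = ev p' f.
  rewrite /F; case: (cid _) => g /= e; apply: mle_anti;
  by apply/(presents_le pC')/(presents_le pC); rewrite e.
have GE f : G (ev p' f) = ev p f.
  rewrite /G; case: (cid _) => g /= e; apply: mle_anti;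
  by apply/(presents_le pC)/(presents_le pC'); rewrite e.
have Flin : semilinear F.
  split=> [a v|v w].
    by have [f ->] := presents_surj pC v; rewrite -evZ !FE evZ.
  have [f ->] := presents_surj pC v; have [g ->] := presents_surj pC w.
  by rewrite -evD !FE evD.
pose Fl : {linear N -> N'} :=
  HB.pack F (GRing.isSemilinear.Build (Rmax R) N N' *:%R F Flin).
exists Fl; exists G => v.
  by have [f ->] := presents_surj pC v; rewrite /= FE GE.
by have [f ->] := presents_surj pC' v; rewrite /= GE FE.
Qed.

(** * Circuits of a geometric module *)

Section GeometricPresentation.
Context {R : realType} {E : choiceType} {N : lSemiModType (Rmax R)}.
Implicit Types (f g h c : free_module R E).
Implicit Types (x y z e : E) (a b t : Rmax R) (u v w q : N).

Lemma upd_scale a f x : upd (a *: f) x 0 = a *: upd f x 0.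
Proof.
by apply: free_eq => y; rewrite fcoefZ !updE fcoefZ; case: eqP; rewrite ?mulr0.
Qed.

Lemma bend_scale (p : E -> N) a f : bend p f -> bend p (a *: f).
Proof.
by move=> bf x; rewrite upd_scale evZ fcoefZ -scalerA; apply: mleZ.
Qed.

(** [k] is the least ratio of [f y] to [h y] over the support of [h], attained at [u]. *)
Lemma scale_touching f h : h != 0 -> (forall e, h e != 0 -> f e != 0) ->
  exists (k : Rmax R) (u : E), [/\ k != 0, h u != 0, k * h u = f u &
    forall y, k * h y <= f y].
Proof.
move=> h0 hf; have [x hx] := free_neq0 h0.
pose F y := f y * rmax_inv (h y).
have min_exists (s : seq E) : s != [::] ->
    exists2 u, u \in s & {in s, forall y, F u <= F y}.
  elim: s => [//|y s IH] _; have [->|/IH[u us umin]] := eqVneq s [::].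
    by exists y; rewrite ?inE // => z; rewrite inE => /eqP->.
  have [yu|uy] := leP (F y) (F u).
    exists y; first by rewrite inE eqxx.
    move=> z; rewrite inE => /orP[/eqP-> //|zs].
    by apply: le_trans yu _; apply: umin.
  exists u; first by rewrite inE us orbT.
  by move=> z; rewrite inE => /orP[/eqP->|/umin//]; apply: ltW.
have xs : x \in enum_fset (finsupp h).
  by rewrite -[_ \in _]/(x \in finsupp h) mem_finsupp.
have [|u us umin] := min_exists (finsupp h).
  by apply/eqP => e; rewrite e in xs.
have hu : h u != 0 by move: us; rewrite mem_finsupp.
exists (F u), u; split=> //.
- by rewrite rmax_mulf_neq0 ?rmax_inv_neq0 // hf.
- by rewrite -mulrA rmax_mulVr ?mulr1.
- move=> y; have [->|hy] := eqVneq (h y) 0; first by rewrite mulr0 rmax_ge0.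
  have /(rmax_le_mulr (h y)) : F u <= F y by apply: umin; rewrite mem_finsupp.
  by rewrite /F -(mulrA (f y)) rmax_mulVr ?mulr1.
Qed.

Hypothesis geomN : geometric N.

(** Condition (ii) of strong torsion-freeness is applied to [w] and [w + b *: q] with the scalars
    [a / b < 1] and [1]; as these differ, [w] equals [w + b *: q]. *)
Lemma geometric_absorb w q a b : a < b ->
  mle (b *: q) (w + a *: q) -> mle (b *: q) w.
Proof.
move=> ab h; have [t t1 abt] := rmax_ltdivP ab.
have [_ _ [_ stf]] := geomN.
have eab : w + a *: q = w + b *: q.
  by apply: mle_anti; apply/mle_add; split=> //;
    apply: mle_trans (mleZr _ (ltW ab)) _.
have [|||| t1'|[_ e]] := stf w (w + b *: q) t 1.
- by [].
- exact: ltW t1.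
- exact: lexx.
- by rewrite add_absorb ?ltW // scalerA -abt scale1r addrA maddxx.
- by rewrite t1' ltxx in t1.
by rewrite e scale1r addrA maddxx.
Qed.

Variable p : E -> N.
Hypothesis basis_p : atom_basis p.

(** By semimodularity the weak cover of [0] by the atom [b *: p e] can be translated by [w], and
    [w + q] lies in the resulting interval. *)
Lemma geometric_exchange w q b e : mle q (w + b *: p e) ->
  exists2 a : Rmax R, a <= 1 & w + q = w + a *: (b *: p e).
Proof.
move=> h; have [b0|b0] := eqVneq b 0.
  exists 0; first exact: rmax_ge0.
  by move: h; rewrite b0 !scale0r !addr0 addrC.
have [_ smod _] := geomN.
have /(smod _ _ w)[_] := weakly_covers0_atom (atom_scale b0 (basis_atom basis_p e)).
rewrite add0r addrC => cov; have [|a a1 ea] := cov (w + q).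
  by split=> //; apply/mle_add.
by exists a => //; rewrite ea add_absorb.
Qed.

Section MinimalCombination.
Variable q : N.
Let spans g := mle q (ev p g).
Let minimal_at g y := forall t, t < g y -> ~ spans (upd g y t).

(** If the term at [y] cannot be dropped, exchange lowers [g y] to [a * g y], where this term and
    [q] have the same sum with the rest. Were a smaller coefficient enough, the term would be
    absorbed and could be dropped after all. *)
Lemma spans_minimal_at g y : spans g -> exists g', [/\ forall z, g' z <= g z,
  forall z, z != y -> g' z = g z, spans g' & minimal_at g' y].
Proof.
move=> sg; have [s0|s0] := pselect (spans (upd g y 0)).
  exists (upd g y 0); split=> //.
  - by move=> z; rewrite updE; case: eqP => // _; apply: rmax_ge0.
  - by move=> z zy; rewrite updE (negbTE zy).
  - by move=> t; rewrite updE eqxx ltNge rmax_ge0.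
have : mle q (ev p (upd g y 0) + g y *: p y) by rewrite addrC -ev_split.
case/geometric_exchange=> a a1; rewrite scalerA => ea.
exists (upd g y (a * g y)); split.
- by move=> z; rewrite updE; case: eqP => // ->; apply: rmax_le1_mul.
- by move=> z zy; rewrite updE (negbTE zy).
- by rewrite /spans ev_upd addrC -ea.
move=> t; rewrite updE eqxx => tlt st; apply: s0.
have upd2 : upd (upd g y (a * g y)) y t = upd g y t.
  by apply: free_eq => z; rewrite !updE; case: eqP.
rewrite /spans upd2 ev_upd addrC in st.
have : mle (a * g y *: p y) (ev p (upd g y 0) + t *: p y).
  apply: (@mle_trans _ _ (ev p (upd g y 0) + q)); first by rewrite ea.
  by apply/mle_add.
move=> /(geometric_absorb tlt) h; apply: (@mle_trans _ _ (ev p (upd g y 0) + q)) => //.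
by rewrite ea; apply/mle_add.
Qed.

(* Minimality at a coordinate survives when other coordinates decrease, so
   the coordinates can be minimized one after the other. *)
Lemma spans_minimal g : spans g -> exists g', [/\ forall z, g' z <= g z,
  spans g' & forall y, minimal_at g' y].
Proof.
move=> sg; suff H (s : seq E) : exists g', [/\ forall z, g' z <= g z,
    spans g' & forall y, y \in s -> minimal_at g' y].
  have [g' [le sg' mg']] := H (finsupp g); exists g'; split=> // y.
  have [ys|ys] := boolP (y \in finsupp g); first exact: mg'.
  move=> t tlt; have := lt_le_trans tlt (le y).
  by rewrite (fsfun_dflt ys) ltNge rmax_ge0.
elim: s => [|y s [g1 [le1 s1 m1]]]; first by exists g.
have [g2 [le2 eq2 s2 m2]] := spans_minimal_at y s1.
exists g2; split=> [z||z]; [exact: le_trans (le2 z) (le1 z)|by []|].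
have [->//|zy] := eqVneq z y; rewrite inE (negbTE zy) /= => /m1 mz t.
rewrite eq2 // => /mz ns s2'; apply: ns; apply: mle_trans s2' _.
by apply: ev_mono => e; rewrite !updE; case: eqP.
Qed.

End MinimalCombination.

(** Since [f x < b], the term of [f] at [x] is absorbed. Minimizing the other coefficients and
    putting [b] at [x] gives the circuit. *)
Lemma span_circuit f b x : f x < b -> mle (b *: p x) (ev p f) ->
  exists c, [/\ minimal_bend p c, c x = b & forall y, y != x -> c y <= f y].
Proof.
move=> fxb; have b0 := rmax_lt_neq0 fxb.
rewrite (ev_split p f x) addrC => /(geometric_absorb fxb).
case/spans_minimal=> g [gf sg gmin].
have gx : g x = 0 by apply: rmax_le0; have := gf x; rewrite updE eqxx.
pose c := upd g x b.
have cx : c x = b by rewrite updE eqxx.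
have cg y : y != x -> c y = g y by move=> yx; rewrite updE (negbTE yx).
exists c; split=> //; last first.
  by move=> y yx; rewrite cg //; have := gf y; rewrite updE (negbTE yx).
have not_spans y : g y != 0 -> ~ mle (b *: p x) (ev p (upd g y 0)).
  by rewrite -rmax_gt0; apply: gmin.
split.
- apply/eqP => c0; move: cx; rewrite c0 fcoef0 => b0'.
  by rewrite -b0' eqxx in b0.
- move=> y; have [->|yx] := eqVneq y x.
    rewrite cx; suff -> : upd c x 0 = g by [].
    by apply: free_eq => z; rewrite !updE; case: eqP => // ->.
  rewrite cg //.
  have : mle (b *: p x) (ev p (upd g y 0) + g y *: p y) by rewrite addrC -ev_split.
  case/geometric_exchange=> a a1; rewrite scalerA => ea.
  (* Otherwise the coefficient at [y] could be lowered to [a * g y]: with the rest of [g], this term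
     has the same sum as [b *: p x]. *)
  have aleg : g y <= a * g y.
    rewrite leNgt; apply/negP => /gmin; apply.
    by rewrite ev_upd addrC -ea.
  apply: (mle_trans (mleZr _ aleg)).
  suff -> : upd c y 0 = upd (upd g y 0) x b.
    rewrite ev_upd.
    have -> : upd (upd g y 0) x 0 = upd g y 0.
      apply: free_eq => z; rewrite !updE; case: eqP => // ->.
      by rewrite gx; case: eqP.
    by rewrite [X in mle _ X]addrC ea.
  apply: free_eq => z; rewrite !updE; case: (eqVneq z y) => // ->.
  by rewrite (negbTE yx).
move=> h0 h0_neq0 bh0 h0c e ce; apply/negP => /eqP h0e.
(* A bend that misses [e] is scaled to lie below [c] and touch it at [u]. *)
have [k [u [k0 h0u ku kle]]] := scale_touching h0_neq0 h0c.
pose h := k *: h0.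
have hle y : h y <= c y by rewrite fcoefZ.
have bh : bend p h by apply: bend_scale.
have he : h e = 0 by rewrite fcoefZ h0e mulr0.
have cu0 : c u != 0 by apply: h0c.
have hu : h u = c u by rewrite fcoefZ.
(* If [h x] were [b], the bend relation of [h] at [x] would bound [b *: p x] without the help of
   [e]. *)
have xcase : h x <> b.
  move=> hx; have ex : e != x by apply: contra_neq b0 => ex; rewrite -hx -ex.
  apply: (not_spans e); first by rewrite -cg.
  rewrite -hx; apply: mle_trans (bh x) _; apply: ev_mono => y; rewrite !updE.
  case: (eqVneq y x) => [_|yx]; first exact: rmax_ge0.
  by case: (eqVneq y e) => [->|_]; rewrite ?he // -cg.
have ux : u != x by apply/eqP => ux; apply: xcase; rewrite -cx -ux.
have hxb : h x < b.
  by rewrite lt_neqAle; apply/andP; split; [apply/eqP|rewrite -cx].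
apply: (not_spans u); first by rewrite -cg.
apply: (geometric_absorb hxb); apply: mle_trans sg _.
rewrite (ev_split p g u); apply/mle_add; split=> //.
rewrite -cg // -hu; apply: mle_trans (bh u) _.
rewrite addrC; have -> : upd g u 0 = upd (upd g u 0) x 0.
  apply: free_eq => z; rewrite !updE; case: (eqVneq z x) => // ->.
  by rewrite gx; case: eqP.
rewrite -ev_upd; apply: ev_mono => y; rewrite !updE.
case: (eqVneq y x) => [->|yx]; first by case: eqP => // _; apply: rmax_ge0.
by case: (eqVneq y u) => // _; rewrite -cg.
Qed.

Lemma bend_presents : presents [set f | minimal_bend p f] p.
Proof.
split=> [v|f g]; last first.
  split=> [fg x|fg]; last first.
    apply: ev_le => x _; have [le|[c [[_ bc _] cx cg]]] := fg x.
      by apply: mle_trans (mleZr _ le) (ev_term p g x).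
    rewrite -cx; apply: mle_trans (bc x) _; apply: ev_mono => y; rewrite updE.
    by case: (eqVneq y x) => [_|/cg//]; apply: rmax_ge0.
  have [le|lt] := leP (f x) (g x); [by left|right].
  by apply: span_circuit => //; apply: mle_trans (ev_term p f x) fg.
have [atN _ _] := geomN; have [s [sat ->]] := atN v.
elim: s sat => [|q s IH] sat; first by exists 0; rewrite big_nil ev0.
have [y ys|f sf] := IH; first by apply: sat; rewrite inE ys orbT.
have [|x [a [a0 ->]]] := basis_surj basis_p (q := q).
  by apply: sat; rewrite inE eqxx.
by exists (a *: free_gen R x + f); rewrite big_cons sf evD evZ ev_gen.
Qed.

Lemma minimal_bend_circuit_system : circuit_system [set f | minimal_bend p f].
Proof.
split.
- by case; rewrite eqxx.
- move=> X Y [X0 bX _] [_ _ Ymin] XY; exact: Ymin.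
- move=> X a [X0 bX Xmin] a0.
  have eq0 e : ((a *: X) e != 0) = (X e != 0).
    rewrite fcoefZ; apply/idP/idP; last exact: rmax_mulf_neq0.
    by apply: contra_neq => ->; rewrite mulr0.
  split.
  + have [x Xx] := free_neq0 X0; apply/eqP => aX0.
    by have := eq0 x; rewrite Xx aX0 fcoef0 eqxx.
  + exact: bend_scale.
  + move=> g g0 bg gX e; rewrite eq0; apply: Xmin => // y /gX.
    by rewrite eq0.
move=> X Y u v [X0 bX _] [Y0 bY _] XYu Xu YXv.
have uv : u != v by apply: contraTneq YXv => <-; rewrite XYu ltxx.
(* The bend relations of [X] at [v] and of [Y] at [u] together bound [X v *: p v] by
   [Y v *: p v + ev p f]. As [Y v < X v], the first summand is absorbed, and [span_circuit] yields
   the circuit. *)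
pose f := upd (upd (X + Y) u 0) v 0.
have fu : f u = 0 by rewrite !updE eqxx; case: eqP.
have fv : f v = 0 by rewrite updE eqxx.
have fE y : y != u -> y != v -> f y = X y + Y y.
  by move=> yu yv; rewrite !updE (negbTE yu) (negbTE yv) fcoefD.
have Xle : mle (X v *: p v) (X u *: p u + ev p f).
  apply: mle_trans (bX v) _; have -> : f = upd f u 0.
    by apply: free_eq => z; rewrite [RHS]updE; case: eqP => // ->.
  rewrite -ev_upd; apply: ev_mono => y; rewrite [X in X <= _]updE [X in _ <= X]updE.
  case: (eqVneq y v) => [_|yv]; first exact: rmax_ge0.
  case: (eqVneq y u) => [->//|yu]; by rewrite fE // rmax_leDl.
have Yle : mle (Y u *: p u) (Y v *: p v + ev p f).
  apply: mle_trans (bY u) _; have -> : f = upd f v 0.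
    by apply: free_eq => z; rewrite [RHS]updE; case: eqP => // ->.
  rewrite -ev_upd; apply: ev_mono => y; rewrite [X in X <= _]updE [X in _ <= X]updE.
  case: (eqVneq y u) => [_|yu]; first exact: rmax_ge0.
  case: (eqVneq y v) => [->//|yv]; by rewrite fE // rmax_leDr.
have : mle (X v *: p v) (ev p f).
  apply: (geometric_absorb YXv); apply: mle_trans Xle _; apply/mle_add; split=> //.
  by rewrite XYu addrC.
have fXv : f v < X v by rewrite fv rmax_gt0; apply: rmax_lt_neq0 YXv.
case/(span_circuit fXv)=> c [mc cv cf]; exists c; split=> //.
  by apply: rmax_le0; have := cf u uv; rewrite fu.
move=> e; have [->|eNv] := eqVneq e v; first by rewrite cv rmax_leDl.
apply: le_trans (cf e eNv) _; have [->|eu] := eqVneq e u.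
  by rewrite fu rmax_ge0.
by rewrite fE.
Qed.

(** A bend supported at one point would make an atom zero, and one supported at two points would
    make two basis atoms proportional. *)
Lemma minimal_bend_simple : cs_simple [set f | minimal_bend p f].
Proof.
move=> f [f0 bf _] x y; have [x1 fx1] := free_neq0 f0.
have [x2 x21 fx2] : exists2 x2, x2 != x1 & f x2 != 0.
  apply: contrapT => h; have := bf x1.
  suff -> : upd f x1 0 = 0.
    rewrite ev0 => /mlex0; rewrite -[RHS](scaler0 _ (f x1)) => /(scaler_rmaxI fx1).
    by apply/eqP; apply: atom_neq0 (basis_atom basis_p x1).
  apply: free_eq => z; rewrite updE fcoef0; case: eqP => // /eqP zx1.
  by apply: contrapT => /eqP fz; apply: h; exists z.
have [x3 [x31 x32 fx3]] : exists x3, [/\ x3 != x1, x3 != x2 & f x3 != 0].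
  apply: contrapT => h; have := bf x1.
  have -> : upd f x1 0 = f x2 *: free_gen R x2.
    apply: free_eq => z; rewrite updE fcoefZ fcoef_gen.
    case: (eqVneq z x2) => [->|zx2]; first by rewrite (negbTE x21) mulr1.
    rewrite mulr0; case: (eqVneq z x1) => // zx1.
    by apply: contrapT => /eqP fz; apply: h; exists z.
  rewrite evZ ev_gen => le.
  have [a _] := mle_atom (atom_scale fx2 (basis_atom basis_p x2)) le.
  rewrite scalerA => /(basis_inj basis_p fx1) e.
  by rewrite e eqxx in x21.
have [x1x|x1x] := eqVneq x1 x; have [x1y|x1y] := eqVneq x1 y; last by exists x1.
- by exists x2; rewrite -x1x -x1y.
- have [x2y|x2y] := eqVneq x2 y; last by exists x2; rewrite -x1x.
  by exists x3; rewrite -x1x -x2y.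
- have [x2x|x2x] := eqVneq x2 x; last by exists x2; rewrite -x1y.
  by exists x3; rewrite -x1y -x2x.
Qed.

End GeometricPresentation.

(** * Representatives of atoms up to scaling *)

Section AtomRepresentatives.
Context {R : realType} (N : lSemiModType (Rmax R)).
Implicit Types (q : N) (a : Rmax R).

Definition proportional_atoms q : set N :=
  [set r | atom r /\ exists2 a : Rmax R, a != 0 & r = a *: q].

Lemma proportional_atomsZ q a : a != 0 ->
  proportional_atoms (a *: q) = proportional_atoms q.
Proof.
move=> a0; apply/seteqP; split=> r [ra [b b0 e]]; split; rewrite // e.
  by exists (b * a); rewrite ?rmax_mulf_neq0 ?scalerA.
exists (b * rmax_inv a); rewrite ?rmax_mulf_neq0 ?rmax_inv_neq0 //.
by rewrite scalerA -mulrA rmax_mulVr // mulr1.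
Qed.

(** The choice depends on the set alone, so proportional atoms get the same representative. *)
Definition atom_repr q : N := xget 0 (proportional_atoms q).

Definition is_atom_repr : pred N := fun q => `[< atom q /\ atom_repr q = q >].

Definition atom_reprs : choiceType := {q : N | is_atom_repr q}.

Lemma atom_reprP q : atom q -> proportional_atoms q (atom_repr q).
Proof.
move=> qa; apply: (@xgetPex _ 0 (proportional_atoms q)); exists q; split=> //.
by exists 1; rewrite ?scale1r.
Qed.

Lemma atom_reprs_basis : atom_basis (val : atom_reprs -> N).
Proof.
split.
- by case=> q /= /asboolP[].
- move=> [q qP] [r rP] a b a0 /= e; apply: val_inj => /=.
  have /asboolP[qa qr] := qP; have /asboolP[ra rr] := rP.
  have b0 : b != 0.
    apply/eqP => b0; move: e; rewrite b0 scale0r -[RHS](scaler0 _ a).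
    by move=> /(scaler_rmaxI a0)/eqP; apply/negP; apply: atom_neq0.
  rewrite -qr -rr /atom_repr -(proportional_atomsZ q a0) e.
  by rewrite proportional_atomsZ.
move=> q qa; have [ra [a a0 e]] := atom_reprP qa.
have rP : is_atom_repr (atom_repr q).
  apply/asboolP; split=> //.
  by rewrite [X in atom_repr X]e /atom_repr proportional_atomsZ.
exists (exist _ (atom_repr q) rP), (rmax_inv a); split; first exact: rmax_inv_neq0.
by rewrite /= e scalerA rmax_mulVr // scale1r.
Qed.

End AtomRepresentatives.

(** * Infinite valuated matroids *)

Section CircuitsOfMatroid.
Context {R : realType} {E : choiceType}.
Implicit Types (M : infinite_valuated_matroid R E) (eta : E -> Rmax R).
Implicit Types (C : set (free_module R E)) (f g X Y Z : free_module R E).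

Definition circuits M : set (free_module R E) := [set f | circuit M f].

Lemma extend0_in (S : {fset E}) (X : {ffun S -> Rmax R}) (e : S) :
  extend0 X (val e) = X e.
Proof. by rewrite /extend0 valK. Qed.

Lemma extend0_supp (S : {fset E}) (X : {ffun S -> Rmax R}) y :
  extend0 X y != 0 -> y \in S.
Proof. by rewrite /extend0; case: insubP => [//|_]; rewrite eqxx. Qed.

Lemma extend0_restr (S : {fset E}) eta : (forall y, eta y != 0 -> y \in S) ->
  extend0 [ffun e : S => eta (val e)] = eta.
Proof.
move=> etaS; apply/funext => y; rewrite /extend0.
case: insubP => [e yS <-|yS]; first by rewrite ffunE.
by apply/esym/eqP; apply: contraNT yS; apply: etaS.
Qed.

Lemma circuit_free M eta : circuit M eta ->
  exists f, circuits M f /\ eta = f.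
Proof.
move=> Ceta; have [S [X [_ e]]] := Ceta.
have feta : eta = free_of S eta.
  by apply/funext => y; rewrite free_ofE // e; apply: extend0_supp.
by exists (free_of S eta); rewrite /circuits /= -feta.
Qed.

(** [X] comes from some finite [S0]; it is lifted to the union of [S0] and [S], then restricted to
    [S]. *)
Lemma ivm_on_circuit M (S : {fset E}) X :
  circuits M X -> (forall y, X y != 0 -> y \in S) ->
  ivm_on M S [ffun e : S => X (val e)].
Proof.
move=> [S0 [X0 [MX0 eX]]] XS.
have sub0 : (S0 `<=` S0 `|` S)%fset := fsubsetUl S0 S.
have sub : (S `<=` S0 `|` S)%fset := fsubsetUr S0 S.
move: MX0; rewrite -(ivm_restrict M sub0) => -[X' [MX' suppX' eX']].
have X'E t : X' t = X (val t).
  rewrite eX /extend0; case: insubP => [e tS0 et|tS0].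
    by rewrite -eX' ffunE; congr (X' _); apply: val_inj.
  apply/eqP; apply: contraNT tS0 => X't.
  by apply: suppX'; rewrite inE.
rewrite -(ivm_restrict M sub); exists X'; last first.
  by apply/ffunP => e; rewrite !ffunE X'E.
by split=> // e; rewrite inE X'E => /XS.
Qed.

Lemma circuits_ivm_on M (S : {fset E}) X : (forall y, X y != 0 -> y \in S) ->
  ivm_on M S [ffun e : S => X (val e)] -> circuits M X.
Proof.
by move=> XS MX; exists S, [ffun e : S => X (val e)]; rewrite extend0_restr.
Qed.

(** Each hypothesis concerns at most two circuits, so it can be moved to a finite set containing
    their supports. *)
Lemma circuits_system M : circuit_system (circuits M).
Proof.
split.
- move=> C0; apply: (vm_nonzero (ivm_matroid M fset0)).
  have -> : [ffun=> 0] = [ffun e : fset0 => (0 : free_module R E) (val e)].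
    by apply/ffunP => -[].
  by apply: ivm_on_circuit => // y; rewrite fcoef0 eqxx.
- move=> X Y CX CY XY e Ye; apply: contrapT => /negP; rewrite negbK => /eqP Xe.
  have YS y : Y y != 0 -> y \in finsupp Y by rewrite mem_finsupp.
  have XS y : X y != 0 -> y \in finsupp Y by move=> /XY/YS.
  have := vm_incomparable (ivm_matroid M _)
    (ivm_on_circuit CX XS) (ivm_on_circuit CY YS).
  move=> /(_ _)/negP; apply; last first.
    by apply/fintype.subsetP => y; rewrite !inE !ffunE => /XY.
  apply/eqP => /setP/(_ [` YS e Ye]%fset); rewrite !inE !ffunE /= Xe Ye.
  by rewrite eqxx.
- move=> X a CX a0.
  have XS y : X y != 0 -> y \in finsupp X by rewrite mem_finsupp.
  have := vm_scale (ivm_matroid M _) (ivm_on_circuit CX XS) a0.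
  have -> : [ffun e => a * [ffun e : finsupp X => X (val e)] e] =
            [ffun e : finsupp X => (a *: X) (val e)].
    by apply/ffunP => e; rewrite !ffunE fcoefZ.
  apply: circuits_ivm_on => y; rewrite fcoefZ => aXy; apply: XS.
  by apply: contra_neq aXy => ->; rewrite mulr0.
move=> X Y u v CX CY XYu Xu YXv.
pose S := (finsupp X `|` finsupp Y)%fset.
have XS y : X y != 0 -> y \in S by rewrite in_fsetU mem_finsupp => ->.
have YS y : Y y != 0 -> y \in S by rewrite in_fsetU !mem_finsupp orbC => ->.
have uS := XS u Xu; have vS := XS v (rmax_lt_neq0 YXv).
have := vm_elimination (ivm_matroid M S) (ivm_on_circuit CX XS) (ivm_on_circuit CY YS).
move=> /(_ [` uS]%fset [` vS]%fset); rewrite !ffunE /=.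
case=> // Z [MZ Zu Zv Zle].
have [|f [Cf ef]] := @circuit_free M (extend0 Z); first by exists S, Z.
have fS (e : S) : f (val e) = Z e by rewrite -ef extend0_in.
exists f; split=> //.
- by rewrite -[u]/(val [` uS]%fset) fS.
- by rewrite -[v]/(val [` vS]%fset) fS.
move=> e; have [eS|eS] := boolP (e \in S).
  by have := Zle [` eS]%fset; rewrite -fS !ffunE /= rmax_addE.
suff -> : f e = 0 by apply: rmax_ge0.
by apply/eqP; apply: contraNT eS; rewrite -ef; apply: extend0_supp.
Qed.

Lemma simple_circuits M : simple M <-> cs_simple (circuits M).
Proof.
split=> [sM X CX x y|sC eta /circuit_free[f [Cf ->]]].
  apply: contrapT => h; have := sM _ CX; apply/negP.
  (* A support contained in the two points [x] and [y] is covered by the image of a set of two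
     elements. *)
  apply: (contraNN _ (_ : ~~ (`I_3 #<= `I_2)%card)); last by rewrite card_le_II.
  move=> /card_le_trans; apply.
  apply: card_le_trans (card_image_le (fun n => if n == 0%N then x else y) _).
  apply: subset_card_le => z /= Xz; have [->|zx] := eqVneq z x; first by exists 0%N.
  have [->|zy] := eqVneq z y; first by exists 1%N.
  by case: h; exists z.
have [x0 _] : exists x, f x != 0.
  by apply: free_neq0; apply/eqP => f0; apply: (cs_nonzero (circuits_system M));
    rewrite -f0.
have [x1 [_ _ fx1]] := sC f Cf x0 x0.
have [x2 [x21 _ fx2]] := sC f Cf x1 x1.
have [x3 [x31 x32 fx3]] := sC f Cf x1 x2.
pose h n := nth x1 [:: x1; x2; x3] n.
have hinj : {in `I_3 &, injective h}.
  have u3 : uniq [:: x1; x2; x3].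
    by rewrite /= !inE negb_or eq_sym x21 eq_sym x31 eq_sym x32.
  by move=> i j; rewrite !inE => i3 j3 /eqP; rewrite nth_uniq // => /eqP.
have /card_eqPle[_ le] := inj_card_eq hinj.
apply: card_le_trans le (subset_card_le _) => _ [[|[|[|//]]] _ <-] //.
Qed.

(** * The infinite valuated matroid of a circuit system *)

Section MatroidOfCircuits.
Variable C : set (free_module R E).
Hypothesis csC : circuit_system C.

Definition circuits_on (S : {fset E}) : set {ffun S -> Rmax R} :=
  [set X | exists f, [/\ C f, forall y, f y != 0 -> y \in S &
                         X = [ffun e : S => f (val e)]]].

Lemma circuits_on_matroid S : is_valuated_matroid (@circuits_on S).
Proof.
split.
- case=> f [Cf fS f0]; apply: (cs_nonzero csC).
  suff <- : f = 0 by [].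
  apply: free_eq => y; rewrite fcoef0; apply: contrapT => /eqP fy.
  have /ffunP/(_ [` fS y fy]%fset) := f0; rewrite !ffunE /= => /esym/eqP.
  exact/negP.
- move=> _ _ [f [Cf fS ->]] [g [Cg gS ->]] neq; apply/negP => /fintype.subsetP sub.
  have fg e : f e != 0 -> g e != 0.
    by move=> fe; have := sub [` fS e fe]%fset; rewrite !inE !ffunE; apply.
  have gf := cs_incomparable csC Cf Cg fg.
  case/eqP: neq; apply/setP => e; rewrite !inE !ffunE.
  by apply/idP/idP; [apply: fg|apply: gf].
- move=> _ a [f [Cf fS ->]] a0; exists (a *: f); split; first exact: cs_scale.
    move=> y; rewrite fcoefZ => afy; apply: fS.
    by apply: contra_neq afy => ->; rewrite mulr0.
  by apply/ffunP => e; rewrite !ffunE fcoefZ.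
move=> _ _ u v [f [Cf fS ->]] [g [Cg gS ->]]; rewrite !ffunE => fgu fu gfv.
have [h [Ch hu hv hle]] := cs_elimination csC Cf Cg fgu fu gfv.
exists [ffun e : S => h (val e)]; rewrite !ffunE; split=> //.
  exists h; split=> // y hy; apply: contrapT => /negP yS.
  case/eqP: hy; apply: rmax_le0; apply: le_trans (hle y) _.
  have -> : f y = 0 by apply/eqP; apply: contraNT yS; apply: fS.
  have -> : g y = 0 by apply/eqP; apply: contraNT yS; apply: gS.
  by rewrite addr0.
by move=> e; rewrite !ffunE -rmax_addE.
Qed.

Lemma circuits_on_restrict (S S' : {fset E}) (sub : (S' `<=` S)%fset) :
  vm_restrict sub (@circuits_on S) = @circuits_on S'.
Proof.
apply/seteqP; split=> [_ [_ [[f [Cf fS ->]] supp] <-]|_ [f [Cf fS' ->]]].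
  exists f; split=> //; last by apply/ffunP => e; rewrite !ffunE.
  by move=> y fy; have := supp [` fS y fy]%fset; rewrite inE ffunE; apply.
exists [ffun e : S => f (val e)]; last by apply/ffunP => e; rewrite !ffunE.
split; last by move=> e; rewrite inE ffunE; apply: fS'.
by exists f; split=> // y /fS'; apply/fsubsetP.
Qed.

Definition matroid_of_circuits : infinite_valuated_matroid R E :=
  IVM circuits_on_matroid circuits_on_restrict.

Lemma circuits_matroid_of_circuits : circuits matroid_of_circuits = C.
Proof.
apply/seteqP; split=> f.
  case=> S [_ [[g [Cg gS ->]] e]].
  suff -> : f = g by [].
  by apply: free_eq => y; rewrite e extend0_restr.
move=> Cf; apply: (@circuits_ivm_on _ (finsupp f)).
  by move=> y; rewrite mem_finsupp.
by exists f; split=> // y; rewrite mem_finsupp.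
Qed.

End MatroidOfCircuits.

End CircuitsOfMatroid.

(** * The presentation of Q_M by the circuits of M *)

Section QmodPresentation.
Context {R : realType} {E : choiceType} (M : infinite_valuated_matroid R E).
Implicit Types (f g c : free_module R E).

Definition Qgen (x : E) : Qmod M :=
  \pi_(quotient_module (bend_relation M)) (free_gen R x).

Let Qpi (f : free_module R E) : Qmod M := \pi_(quotient_module (bend_relation M)) f.

Lemma ev_Qgen f : ev Qgen f = Qpi f.
Proof.
have pi_semilinear : semilinear Qpi.
  split=> [a u|u v]; first by rewrite [RHS]quot_scaleE.
  by rewrite [RHS]quot_addE.
pose Qpil : {linear free_module R E -> Qmod M} :=
  HB.pack Qpi (GRing.isSemilinear.Build (Rmax R) _ _ *:%R Qpi pi_semilinear).
by rewrite -[in RHS](ev_free_gen f) -[Qpi]/(Qpil : _ -> _) linear_ev.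
Qed.

Lemma fsbig_free (A : set E) c :
  \sum_(y \in A) c y *: free_gen R y =
  free_of (finsupp c) (fun y => if y \in A then c y else 0).
Proof.
rewrite fsbig_mkcond (@fsbigTE _ _ _ _ (finsupp c)); last first.
  move=> y yc; rewrite /patch; case: ifP => // _.
  by rewrite (fsfun_dflt yc) scale0r.
rewrite -[RHS]ev_free_gen (ev_widen _ (S := finsupp c)).
  apply: eq_bigr => y _; rewrite /patch free_ofE.
    by case: ifP; rewrite ?scale0r.
  by move=> z; rewrite mem_finsupp; case: ifP => // _; rewrite eqxx.
by move=> y; rewrite fsfun_fun; case: ifP; rewrite ?eqxx.
Qed.

Lemma bend_relationP u v : bend_relation M u v <->
  exists c x, [/\ circuits M c, u = c & v = upd c x 0].
Proof.
have full c : \sum_(y \in [set: E]) c y *: free_gen R y = c.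
  rewrite fsbig_free; apply: free_eq => y; rewrite fsfun_fun in_setT.
  by case: finsuppP.
have but c x : \sum_(y \in [set y | y != x]) c y *: free_gen R y = upd c x 0.
  rewrite fsbig_free; apply: free_eq => y; rewrite fsfun_fun updE.
  have -> : (y \in [set y | y != x]) = (y != x) by apply/idP/idP; rewrite inE.
  by case: eqP => _; case: finsuppP.
split=> [[c [x [/circuit_free[f [Cf ->]] -> ->]]]|[c [x [Cc -> ->]]]].
  by exists f, x; rewrite full but.
by exists c, x; rewrite full but.
Qed.

(** Mutual domination is a congruence that contains the bend relations, hence the generated
    congruence. Conversely, the bend equation of a witnessing circuit bounds the term at [x]. *)
Lemma Qmod_presents : presents (circuits M) Qgen.
Proof.
have csM := circuits_system M.
split=> [q|f g]; first by exists (repr q); rewrite ev_Qgen /Qpi reprK.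
rewrite !ev_Qgen; split=> [fg|fg].
  have : generated_congruence (bend_relation M) (f + g) g.
    by apply/quotient_moduleP; rewrite -[RHS]fg [RHS]quot_addE.
  move=> /(_ (fun u v => dominated (circuits M) u v /\ dominated (circuits M) v u)).
  case.
  - split.
    + by move=> u; split; apply: dominated_le.
    + by move=> u v [].
    + move=> u v w [uv vu] [vw wv]; split.
        exact: (dominated_trans csM uv vw).
      exact: (dominated_trans csM wv vu).
    + move=> u u' v v' [uu' u'u] [vv' v'v]; split; apply: dominatedD.
      * by apply: (dominated_trans csM) uu' _; apply: dominated_le => x;
           rewrite fcoefD rmax_leDl.
      * by apply: (dominated_trans csM) vv' _; apply: dominated_le => x;
           rewrite fcoefD rmax_leDr.
      * by apply: (dominated_trans csM) u'u _; apply: dominated_le => x;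
           rewrite fcoefD rmax_leDl.
      * by apply: (dominated_trans csM) v'v _; apply: dominated_le => x;
           rewrite fcoefD rmax_leDr.
    + by move=> a u v [? ?]; split; apply: dominatedZ.
  - move=> _ _ /bend_relationP[c [x [Cc -> ->]]]; split; last first.
      by apply: dominated_le => y; rewrite updE; case: eqP => // _; apply: rmax_ge0.
    move=> y; have [->|yx] := eqVneq y x; last by left; rewrite updE (negbTE yx).
    by right; exists c; split=> // z zx; rewrite updE (negbTE zx).
  move=> fgg _; apply: (dominated_trans csM) fgg.
  by apply: dominated_le => x; rewrite fcoefD rmax_leDl.
rewrite -!ev_Qgen; apply: ev_le => x _.
have [le|[c [Cc cx cg]]] := fg x.
  by apply: mle_trans (mleZr _ le) (ev_term _ _ _).
have ec : ev Qgen c = ev Qgen (upd c x 0).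
  rewrite !ev_Qgen; apply/quotient_moduleP => r cr gr; apply: gr.
  by apply/bend_relationP; exists c, x.
rewrite -cx; apply: mle_trans (ev_term _ _ _) _; rewrite ec.
apply: ev_mono => y; rewrite updE; case: (eqVneq y x) => [_|/cg//].
exact: rmax_ge0.
Qed.

End QmodPresentation.

(** * Projective equivalence *)

Section PushForward.
Context {R : realType} {E E' : choiceType}.
Variables (phi : E -> E') (phi' : E' -> E) (s : E -> Rmax R).
Hypotheses (phiK : cancel phi phi') (phiK' : cancel phi' phi).
Implicit Types (f g : free_module R E).

(** This is how a projective equivalence with data [phi] and [s] acts on circuits. *)
Definition push f : free_module R E' :=
  free_of [fset phi x | x in finsupp f]%fset (fun y => s (phi' y) * f (phi' y)).

Lemma pushE f y : push f y = s (phi' y) * f (phi' y).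
Proof.
rewrite free_ofE // => z; apply: contraNT => zf.
apply/eqP; suff -> : f (phi' z) = 0 by rewrite mulr0.
apply/eqP; apply: contraNT zf => fz; apply/imfsetP; exists (phi' z) => //=.
by rewrite mem_finsupp.
Qed.

Lemma push_upd f x : push (upd f x 0) = upd (push f) (phi x) 0.
Proof.
apply: free_eq => y; rewrite !(pushE, updE) -(can_eq phiK') phiK.
by case: eqP => // _; rewrite mulr0.
Qed.

Lemma ev_push (N : lSemiModType (Rmax R)) (p : E -> N) (p' : E' -> N) :
  (forall x, p x = s x *: p' (phi x)) -> forall f, ev p' (push f) = ev p f.
Proof.
move=> pp' f; rewrite (ev_widen _ (S := [fset phi x | x in finsupp f]%fset)).
  rewrite big_imfset /=; last by move=> x y _ _; apply: can_inj phiK x y.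
  by apply: eq_bigr => x _; rewrite pushE phiK pp' scalerA mulrC.
move=> y; rewrite pushE => h; apply/imfsetP; exists (phi' y) => //=.
by rewrite mem_finsupp; apply: contra_neq h => ->; rewrite mulr0.
Qed.

Lemma bend_push (N : lSemiModType (Rmax R)) (p : E -> N) (p' : E' -> N) f :
  (forall x, p x = s x *: p' (phi x)) -> bend p f -> bend p' (push f).
Proof.
move=> pp' bf y; rewrite -[y]phiK' -push_upd (ev_push pp').
by rewrite pushE !phiK mulrC -scalerA -pp'.
Qed.

Lemma dominated_push (C : set (free_module R E)) (C' : set (free_module R E')) f g :
  (forall c, C c -> C' (push c)) -> dominated C f g ->
  dominated C' (push f) (push g).
Proof.
move=> CC' fg y; have [le|[c [Cc cx cg]]] := fg (phi' y).
  by left; rewrite !pushE rmax_le_mul.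
right; exists (push c); split; [exact: CC'|by rewrite !pushE cx|].
by move=> z zy; rewrite !pushE rmax_le_mul // cg // (can_eq phiK').
Qed.

End PushForward.

Section PushBack.
Context {R : realType} {E E' : choiceType}.
Variables (phi : E -> E') (phi' : E' -> E) (s : E -> Rmax R).
Hypotheses (phiK : cancel phi phi') (phiK' : cancel phi' phi).
Hypothesis s0 : forall x, s x != 0.
Implicit Types (f g : free_module R E).

Let s' (y : E') : Rmax R := rmax_inv (s (phi' y)).

Lemma pushK f : push phi' phi s' (push phi phi' s f) = f.
Proof.
apply: free_eq => x; rewrite !pushE // /s' !phiK mulrA rmax_mulVr //.
by rewrite mul1r.
Qed.

Lemma push_invK (g : free_module R E') : push phi phi' s (push phi' phi s' g) = g.
Proof.
apply: free_eq => x; rewrite !pushE // /s' !phiK' mulrA rmax_mulV //.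
by rewrite mul1r.
Qed.

(** Supports correspond under [phi], so a bend for [p'] of smaller support would be pulled back by
    the inverse scaling to one for [p]. *)
Lemma minimal_bend_push (N : lSemiModType (Rmax R)) (p : E -> N) (p' : E' -> N) f :
  (forall x, p x = s x *: p' (phi x)) ->
  minimal_bend p f -> minimal_bend p' (push phi phi' s f).
Proof.
move=> pp' [f0 bf fmin].
have p'p y : p' y = s' y *: p (phi' y).
  by rewrite pp' phiK' scalerA rmax_mulVr // scale1r.
have push0 x : (push phi phi' s f x != 0) = (f (phi' x) != 0).
  rewrite pushE //; apply/idP/idP => [|fx]; last exact: rmax_mulf_neq0.
  by apply: contra_neq => ->; rewrite mulr0.
split; last 1 first.
- move=> g g0 bg gf e; rewrite push0 => fe.
  have pull0 x : (push phi' phi s' g x != 0) = (g (phi x) != 0).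
    rewrite pushE //; apply/idP/idP => [|gx].
      by apply: contra_neq => ->; rewrite mulr0.
    by rewrite rmax_mulf_neq0 // rmax_inv_neq0.
  rewrite -[e]phiK' -pull0; apply: fmin => //.
  + have [y gy] := free_neq0 g0; apply/eqP => h.
    by have := pull0 (phi' y); rewrite h fcoef0 phiK' gy eqxx.
  + exact: bend_push p'p bg.
  + by move=> x; rewrite pull0 => /gf; rewrite push0 phiK.
- have [x fx] := free_neq0 f0; apply/eqP => h.
  by have := push0 (phi x); rewrite h fcoef0 phiK fx eqxx.
- exact: bend_push pp' bf.
Qed.

End PushBack.

Lemma projectively_equivalent_iso (R : realType) (E E' : choiceType)
    (M : infinite_valuated_matroid R E) (M' : infinite_valuated_matroid R E') :
  projectively_equivalent M M' -> module_iso (Qmod M) (Qmod M').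
Proof.
move=> [phi [phi' [s [phiK phiK' s0 MM']]]].
have pM := Qmod_presents M; have pM' := Qmod_presents M'.
(* [q x] is where the generator [x] of [Qmod M] should go; it remains to see that the circuits of
   [M] present [Qmod M'] through [q]. *)
pose q x := s x *: Qgen M' (phi x).
have evq f : ev (Qgen M') (push phi phi' s f) = ev q f.
  exact: (ev_push phiK phiK').
pose s' y := rmax_inv (s (phi' y)).
have fwd c : circuits M c -> circuits M' (push phi phi' s c).
  move=> /MM'; congr (circuit M' _); apply/funext => y; by rewrite pushE.
have bwd c : circuits M' c -> circuits M (push phi' phi s' c).
  move=> Cc; apply/MM'; congr (circuit M' _) : Cc; apply/funext => y.
  rewrite pushE // /s' phiK' mulrA rmax_mulV // mul1r; by [].
apply: presents_iso pM (_ : presents (circuits M) q).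
split=> [v|f g].
  have [g ->] := presents_surj pM' v.
  by exists (push phi' phi s' g); rewrite -evq push_invK.
rewrite -!evq; split=> [/(presents_le pM') h|h].
  rewrite -(pushK phiK phiK' s0 f) -(pushK phiK phiK' s0 g).
  exact: (dominated_push phiK bwd).
by apply/(presents_le pM'); apply: (dominated_push phiK' fwd).
Qed.

(** Each atom of one basis is a multiple of an atom of the other; [phi] and [phi'] follow these
    multiples, and [basis_inj] makes them inverse. *)
Lemma atom_bases_match (R : realType) (N : lSemiModType (Rmax R))
    (E E' : choiceType) (p : E -> N) (p' : E' -> N) :
  atom_basis p -> atom_basis p' ->
  exists (phi : E -> E') (phi' : E' -> E) (s : E -> Rmax R),
    [/\ cancel phi phi', cancel phi' phi, (forall x, s x != 0) &
        forall x, p x = s x *: p' (phi x)].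
Proof.
move=> bp bp'.
have /choice[phi phiP] x : exists y, exists a : Rmax R, a != 0 /\ p x = a *: p' y.
  exact (basis_surj bp' (basis_atom bp x)).
have /choice[s sP] := phiP.
have /choice[phi' phiP'] y : exists x, exists a : Rmax R, a != 0 /\ p' y = a *: p x.
  exact (basis_surj bp (basis_atom bp' y)).
exists phi, phi', s; split=> [x|y|x|x]; try by case: (sP x).
  have [b [b0 e]] := phiP' (phi x); have [s0 e'] := sP x.
  apply/esym; apply: (basis_inj bp (a := 1) (b := s x * b)).
    by apply/eqP => /(congr1 (@rmax_val R)).
  by rewrite scale1r {1}e' e scalerA.
have [b [b0 e]] := phiP' y; have [s0 e'] := sP (phi' y).
apply/esym; apply: (basis_inj bp' (a := 1) (b := b * s (phi' y))).
  by apply/eqP => /(congr1 (@rmax_val R)).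
by rewrite scale1r {1}e e' scalerA.
Qed.

(** Through the isomorphism the circuits of [M] also present [Qmod M'], whose two atom bases then
    match up to scaling. Circuits on both sides are minimal bends, which this matching preserves. *)
Lemma iso_projectively_equivalent (R : realType) (E E' : choiceType)
    (M : infinite_valuated_matroid R E) (M' : infinite_valuated_matroid R E') :
  simple M -> simple M' ->
  module_iso (Qmod M) (Qmod M') -> projectively_equivalent M M'.
Proof.
move=> /simple_circuits sM /simple_circuits sM' [F Fbij].
have csM := circuits_system M; have csM' := circuits_system M'.
have pM := Qmod_presents M; have pM' := Qmod_presents M'.
pose q x := F (Qgen M x).
have evq f : ev q f = F (ev (Qgen M) f) by rewrite linear_ev.
have pq : presents (circuits M) q.
  split=> [v|f g].
    have [G FK GK] := Fbij; have [f e] := presents_surj pM (G v).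
    by exists f; rewrite evq -e GK.
  rewrite !evq -(presents_le pM) /mle -linearD; split=> [|->//].
  exact: (bij_inj Fbij).
have [phi [phi' [s [phiK phiK' s0 qE]]]] := atom_bases_match
  (presents_atom_basis pq sM) (presents_atom_basis pM' sM').
exists phi, phi', s; split=> // eta.
have qE' y : Qgen M' y = rmax_inv (s (phi' y)) *: q (phi' y).
  by rewrite qE phiK' scalerA rmax_mulVr // scale1r.
split=> [/circuit_free[f [Cf ->]]|/circuit_free[g [Cg ge]]].
  have /(circuit_minimal_bend csM pq)/(minimal_bend_push phiK phiK' s0 qE) := Cf.
  move=> /(circuit_minimal_bend csM' pM'); congr (circuit M' _).
  by apply/funext => y; rewrite pushE.
have s0' y : rmax_inv (s (phi' y)) != 0 by apply: rmax_inv_neq0.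
have /(circuit_minimal_bend csM' pM')/(minimal_bend_push phiK' phiK s0' qE') := Cg.
move=> /(circuit_minimal_bend csM pq); congr (circuit M _).
apply/funext => x; rewrite pushE // -ge phiK mulrA rmax_mulVr // mul1r; by [].
Qed.

Theorem theoremA8 (R : realType) :
  (forall (E : choiceType) (M : infinite_valuated_matroid R E),
     simple M -> geometric (Qmod M)) /\
  (forall (E E' : choiceType) (M : infinite_valuated_matroid R E)
          (M' : infinite_valuated_matroid R E'),
     simple M -> simple M' ->
     (projectively_equivalent M M' <-> module_iso (Qmod M) (Qmod M'))) /\
  (forall N : lSemiModType (Rmax R), geometric N ->
     exists (E : choiceType) (M : infinite_valuated_matroid R E),
       simple M /\ module_iso N (Qmod M)).
Proof.
split=> [E M /simple_circuits sM|].
  exact: presents_geometric (circuits_system M) (Qmod_presents M) sM.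
split=> [E E' M M' sM sM'|N geomN].
  split; first exact: projectively_equivalent_iso.
  exact: iso_projectively_equivalent.
have basis := atom_reprs_basis N.
pose csC := minimal_bend_circuit_system geomN basis.
exists (atom_reprs N), (matroid_of_circuits csC); split.
  apply/simple_circuits; rewrite circuits_matroid_of_circuits.
  exact: minimal_bend_simple.
(* [N] and the quotient module are presented by the same circuits. *)
have := Qmod_presents (matroid_of_circuits csC).
rewrite circuits_matroid_of_circuits.
exact: presents_iso (bend_presents geomN basis).
Qed.
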